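(* Let $0<\sigma<\pi$. The function $s\mapsto \mathrm{SLs}(s;\sigma)$, defined for $\Re(s)>1$ by \[ \mathrm{SLs}(s;\sigma)=\frac{1}{\Gamma(s-1)}\int_0^\sigma(\theta-\sigma)\left(-2\log\frac{\sin(\theta/2)}{\sin(\sigma/2)}\right)^{s-2}\,\mathrm{d}\theta, \] admits an analytic continuation to all $s\in\mathbb{C}$. For every integer $n\ge -1$, \[ \mathrm{SLs}(-n;\sigma)=\frac{x\,p_n(x)}{2^n(1-x)^{n+1}},\qquad x=\sin^2(\sigma/2). \] In particular, for every integer $n\ge 0$, \[ \mathrm{SLs}(-n;\pi/3)=\frac13\sum_{k=0}^n B_{n-k}^{(-k)}. \]
   Context: The polynomials $p_n(x)$, $q_n(x)$ ($n\ge -1$) are defined by $p_{-1}(x)=0$, $q_{-1}(x)=1$ and the recurrences \[ p_{n+1}(x)=2(nx+1)p_n(x)+2x(1-x)p_n'(x)+q_n(x),\qquad q_{n+1}(x)=(2(n+1)x+1)q_n(x)+2x(1-x)q_n'(x). \] The poly-Bernoulli numbers $B_n^{(k)}$ (for integers $k$, here used with $k\le 0$) are defined by \[ \sum_{n=0}^\infty B_n^{(k)}\frac{t^n}{n!}=\frac{\mathrm{Li}_k(1-e^{-t})}{1-e^{-t}},\qquad \mathrm{Li}_k(z)=\sum_{m=1}^\infty\frac{z^m}{m^k}. \] *)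

(* Defs.v *)
From Stdlib Require Import Reals ZArith Lra Lia ClassicalEpsilon.
From Coquelicot Require Import Coquelicot.
Open Scope R_scope.

Definition Cexp (z : C) : C :=
  (exp (Re z) * cos (Im z), exp (Re z) * sin (Im z)).

(** [a ^ z] for real [a > 0], with the real logarithm of [a]. *)
Definition Rcpow (a : R) (z : C) : C := Cexp (z * RtoC (ln a))%C.

(** Euler's integral; it converges, and defines the Gamma function, only for
    [0 < Re z]. *)
Definition CGamma (z : C) : C :=
  RInt_gen (V := C_R_CompleteNormedModule)
    (fun t => (RtoC (exp (- t)) * Rcpow t (z - 1))%C)
    (at_right 0) (Rbar_locally p_infty).

Definition entire (f : C -> C) : Prop :=
  forall z, ex_derive (K := C_AbsRing) (V := C_NormedModule) f z.

Definition SLs_integrand (s : C) (sigma theta : R) : C :=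
  (RtoC (theta - sigma)
   * Rcpow (- 2 * ln (sin (theta / 2) / sin (sigma / 2))) (s - 2))%C.

(** [F] is the value at [s] of the defining integral of SLs, which is required
    to converge; it is improper at both ends. *)
Definition is_SLs_integral (s : C) (sigma : R) (F : C) : Prop :=
  exists I : C,
    is_RInt_gen (V := C_R_NormedModule)
      (SLs_integrand s sigma) (at_right 0) (at_left sigma) I
    /\ F = (/ CGamma (s - 1) * I)%C.

(** [pq m] is the pair (p_n, q_n) with n = m - 1, as polynomial functions. *)
Fixpoint pq (m : nat) : (R -> R) * (R -> R) :=
  match m with
  | O => (fun _ => 0, fun _ => 1)
  | S m' =>
      let n := IZR (Z.of_nat m' - 1) in
      let (p, q) := pq m' in
      (fun x => 2 * (n * x + 1) * p x + 2 * x * (1 - x) * Derive p x + q x,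
       fun x => (2 * (n + 1) * x + 1) * q x + 2 * x * (1 - x) * Derive q x)
  end.

(** Meaningful for [-1 <= n]. *)
Definition p (n : Z) : R -> R := fst (pq (Z.to_nat (n + 1))).
Definition q (n : Z) : R -> R := snd (pq (Z.to_nat (n + 1))).

Lemma p_init (x : R) : p (-1) x = 0.
Proof. reflexivity. Qed.

Lemma q_init (x : R) : q (-1) x = 1.
Proof. reflexivity. Qed.

Lemma pq_succ (n : Z) (x : R) : (-1 <= n)%Z ->
  p (n + 1) x = 2 * (IZR n * x + 1) * p n x
                + 2 * x * (1 - x) * Derive (p n) x + q n x
  /\ q (n + 1) x = (2 * (IZR n + 1) * x + 1) * q n x
                + 2 * x * (1 - x) * Derive (q n) x.
Proof.
intros Hn; unfold p, q.
replace (Z.to_nat (n + 1 + 1)) with (S (Z.to_nat (n + 1))) by lia.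
simpl; rewrite Z2Nat.id by lia.
replace (n + 1 - 1)%Z with n by lia.
destruct (pq (Z.to_nat (n + 1))); split; reflexivity.
Qed.

(** Convergent for [Rabs z < 1]. *)
Definition Li (k : Z) (z : R) : R :=
  Series (fun m => z ^ S m / powerRZ (INR (S m)) k).

(** The punctured neighbourhood avoids the removable singularity at [t = 0]. *)
Definition poly_bernoulli_egf (k : Z) (B : nat -> R) : Prop :=
  locally' 0 (fun t =>
    is_pseries (fun n => B n / INR (fact n)) t
      (Li k (1 - exp (- t)) / (1 - exp (- t)))).

(** [poly_bernoulli k n] is B_n^(k): the generating function determines the
    sequence. *)
Definition poly_bernoulli (k : Z) : nat -> R :=
  epsilon (inhabits (fun _ => 0)) (poly_bernoulli_egf k).

(* Main.v *)
Require Import Defs.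
From Stdlib Require Import Reals ZArith Lra Lia ClassicalEpsilon.
From Coquelicot Require Import Coquelicot.
Open Scope R_scope.

(** Put [w = sin (theta/2)] and [y = sin (sigma/2)]. The function
    [(theta - sigma) tan (theta/2)] is a power series [sum r_j w^(j+1)] of radius
    at least 1. The substitution [u = -2 log (w/y)], i.e. [w = y e^(-u/2)], turns
    the integral into
    [int_0^oo (sum r_j y^(j+1) e^(-(j+1)u/2)) u^(s-2) du], and termwise
    integration gives [SLs(s) = sum r_j y^(j+1) (2/(j+1))^(s-1)], which is entire
    because the terms decay geometrically. (Dividing by [Gamma(s-1)] requires that
    Gamma has no zero in the right half-plane.)

    At [s = 1 - m] the series is the value at [theta = sigma] of
    [(tan (theta/2) d/dtheta)^m] applied to [(theta - sigma) tan (theta/2)], and the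
    recurrences for [p] and [q] are those of this iterated derivative.

    At [sigma = pi/3] the function [(theta - sigma) tan (theta/2)] satisfies a
    first-order linear differential equation in [log (4 w^2)], which gives a
    binomial recurrence for [3 SLs(-n)]. The antidiagonal sums of poly-Bernoulli
    numbers satisfy the same recurrence, by an identity for the exponential
    generating function [1 / (e^-a + e^-b - 1)] of [B_n^(-k)]. *)

(** Differentiation in theta must not touch the angle sigma inside (theta - sigma) tan (theta/2). So
    the iterated derivatives are studied with two independent angles, which are identified only at
    the end; the [q] part then disappears, because it carries the factor theta - sigma.

    Both ends of the integral are improper. One explicit function controls them: (t/(1+t))^x has
    finite limits at 0 and at infinity, and up to a constant its derivative dominates e^(-a t)
    t^(x-1). Convergence and termwise integration thus reduce to pointwise inequalities.

    Gamma is available only through Euler's integral. A zero z would propagate to all z + n by the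
    functional equation, whereas for Re z large compared with (Im z)^2 the integrand is concentrated
    near t = Re z and, once rotated, cannot cancel.

    The angle pi/3 is special because 4 sin^2 (pi/6) = 1, which makes the coefficients of the
    differential equation numbers free of sigma. *)

(** * Binomial transforms and antidiagonal sums *)

(** [bt n f] is [sum_i C(n,i) f i]; the recursion is Pascal's rule. *)
Fixpoint bt (n : nat) (f : nat -> R) : R :=
  match n with
  | O => f O
  | S n' => bt n' f + bt n' (fun i => f (S i))
  end.

Lemma bt_ext (n : nat) (f g : nat -> R) :
  (forall i, f i = g i) -> bt n f = bt n g.
Proof.
revert f g; induction n as [|n IH]; intros f g H; simpl; [apply H|].
rewrite (IH f g H), (IH (fun i => f (S i)) (fun i => g (S i))); auto.
Qed.

Lemma bt_lin (n : nat) (a b : R) (f g : nat -> R) :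
  bt n (fun i => a * f i + b * g i) = a * bt n f + b * bt n g.
Proof.
revert f g; induction n as [|n IH]; intros f g; simpl; [reflexivity|].
rewrite IH, (IH (fun i => f (S i))); ring.
Qed.

Lemma bt_switch (n k : nat) (f : nat -> nat -> R) :
  bt n (fun i => bt k (fun j => f i j)) = bt k (fun j => bt n (fun i => f i j)).
Proof.
revert f; induction n as [|n IH]; intros f; simpl; [reflexivity|].
rewrite IH, (IH (fun i => f (S i))).
transitivity (1 * bt k (fun j => bt n (fun i => f i j))
              + 1 * bt k (fun j => bt n (fun i => f (S i) j))); [ring|].
rewrite <- bt_lin; apply bt_ext; intros j; ring.
Qed.

Lemma bt_1 (n : nat) : bt n (fun _ => 1) = 2 ^ n.
Proof. induction n as [|n IH]; simpl; [reflexivity|]; rewrite IH; ring. Qed.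

(** The top value [f n] enters the transform with coefficient 1, and everything else involves
    smaller indices. This allows a recurrence containing a transform to be solved for its newest
    term. *)
Lemma bt_top (n : nat) (f g : nat -> R) :
  (forall i, (i < n)%nat -> f i = g i) -> bt n f - f n = bt n g - g n.
Proof.
revert f g; induction n as [|n IH]; intros f g H; simpl; [ring|].
assert (H1 := IH f g (fun i h => H i (Nat.lt_lt_succ_r _ _ h))).
assert (H2 := IH (fun i => f (S i)) (fun i => g (S i))
                (fun i h => H (S i) (proj1 (Nat.succ_lt_mono _ _) h))).
assert (H3 := H n (Nat.lt_succ_diag_r n)); simpl in H2; lra.
Qed.

(** [ad N f] is [sum_{n+k=N} f n k]. *)
Fixpoint ad (N : nat) (f : nat -> nat -> R) : R :=
  match N with
  | O => f O O
  | S M => ad M (fun n k => f (S n) k) + f O (S M)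
  end.

Lemma ad_ext (N : nat) (f g : nat -> nat -> R) :
  (forall n k, f n k = g n k) -> ad N f = ad N g.
Proof.
revert f g; induction N as [|N IH]; intros f g H; simpl; [apply H|].
rewrite (IH (fun n k => f (S n) k) (fun n k => g (S n) k)), H; auto.
Qed.

Lemma ad_lin (N : nat) (a b : R) (f g : nat -> nat -> R) :
  ad N (fun n k => a * f n k + b * g n k) = a * ad N f + b * ad N g.
Proof.
revert f g; induction N as [|N IH]; intros f g; simpl; [reflexivity|].
rewrite (IH (fun n k => f (S n) k) (fun n k => g (S n) k)); ring.
Qed.

Lemma ad_S_r (N : nat) (f : nat -> nat -> R) :
  ad (S N) f = ad N (fun n k => f n (S k)) + f (S N) O.
Proof.
revert f; induction N as [|N IH]; intros f; [simpl; ring|].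
change (ad (S (S N)) f)
  with (ad (S N) (fun n k => f (S n) k) + f O (S (S N))).
rewrite (IH (fun n k => f (S n) k)); simpl; ring.
Qed.

Lemma ad_sum (N : nat) (f : nat -> nat -> R) :
  ad N f = sum_f_R0 (fun k => f (N - k)%nat k) N.
Proof.
revert f; induction N as [|N IH]; intros f; [reflexivity|].
simpl ad; rewrite IH, tech5, Nat.sub_diag; f_equal.
apply sum_eq; intros i Hi; f_equal; lia.
Qed.

(** Coefficient form of "multiplication by [e^t] commutes with convolution":
    [sum_{n+k=N} C(n,i) C(k,j) = C(N+1,i+j+1)]. *)
Lemma ad_bt (N : nat) (f : nat -> nat -> R) :
  ad N (fun n k => bt n (fun i => bt k (fun j => f i j)))
  = bt (S N) (fun m => match m with O => 0 | S M => ad M f end).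
Proof.
revert f; induction N as [|N IH]; intros f; [simpl; ring|].
change (bt (S (S N)) ?h) with (bt (S N) h + bt (S N) (fun i => h (S i))).
rewrite <- IH; simpl ad at 1.
rewrite (ad_ext N _ (fun n k =>
   1 * bt n (fun i => bt k (fun j => f i j))
   + 1 * bt n (fun i => bt k (fun j => f (S i) j)))) by (intros; ring).
rewrite ad_lin, (IH (fun i j => f (S i) j)).
assert (E : bt (S N) (fun M => ad M f)
  = 1 * bt (S N) (fun m => match m with O => 0 | S M => ad M (fun i j => f (S i) j) end)
    + 1 * bt (S N) (fun j => f O j)).
{ rewrite <- bt_lin; apply bt_ext; intros [|M]; simpl; ring. }
change (bt (S N) (fun i => match S i with O => 0 | S M => ad M f end))
  with (bt (S N) (fun M => ad M f)).
rewrite E; simpl; ring.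
Qed.

(** * Poly-Bernoulli numbers of nonpositive index *)

(** On exponential generating functions, [theta] is [f |-> f + (e^t - 1) f']. *)
Definition theta (c : nat -> R) (n : nat) : R :=
  c n + bt n (fun i => c (S i)) - c (S n).

(** [pB k n] is [B_n^(-k)]. *)
Fixpoint pB (k : nat) : nat -> R :=
  match k with
  | O => fun _ => 1
  | S k' => theta (pB k')
  end.

Lemma theta_lin (a b : R) (c d : nat -> R) (n : nat) :
  theta (fun i => a * c i + b * d i) n = a * theta c n + b * theta d n.
Proof.
unfold theta; rewrite (bt_lin n a b (fun i => c (S i)) (fun i => d (S i))); ring.
Qed.

Lemma theta_ext (c d : nat -> R) (n : nat) :
  (forall i, c i = d i) -> theta c n = theta d n.
Proof.
intros H; unfold theta; rewrite !H.
rewrite (bt_ext n _ (fun i => d (S i))); auto.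
Qed.

Lemma theta_bt (k n : nat) (f : nat -> nat -> R) :
  theta (fun i => bt k (fun j => f j i)) n = bt k (fun j => theta (f j) n).
Proof.
revert f; induction k as [|k IH]; intros f; simpl; [reflexivity|].
rewrite <- IH, <- (IH (fun j => f (S j))).
rewrite (theta_ext _ (fun i => 1 * bt k (fun j => f j i)
                               + 1 * bt k (fun j => f (S j) i))) by (intros; ring).
rewrite theta_lin; ring.
Qed.

Lemma pB_l (n k : nat) :
  bt n (fun i => pB k (S i)) = pB (S k) n - pB k n + pB k (S n).
Proof. simpl; unfold theta; ring. Qed.

(** Mirror image of [pB_l]: for the generating function E it reads E_a = E + (e^b - 1) E_b. Instead
    of going through the duality of n and k, the induction on k applies [theta] in the variable n to
    the induction hypothesis, using that [theta] commutes with [bt] in k. *)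
Lemma pB_r (n k : nat) :
  bt k (fun j => pB (S j) n) = pB k (S n) - pB k n + pB (S k) n.
Proof.
revert n; induction k as [|k IH]; intros n.
  simpl; unfold theta; ring.
change (bt (S k) (fun j => pB (S j) n))
  with (bt k (fun j => pB (S j) n) + bt k (fun j => theta (pB (S j)) n)).
rewrite <- theta_bt.
rewrite (theta_ext _ (fun i => 1 * (1 * pB k (S i) + (-1) * pB k i)
                               + 1 * pB (S k) i)) by (intros; rewrite IH; ring).
rewrite theta_lin, (theta_lin 1 (-1) (fun i => pB k (S i))), IH.
change (theta (pB (S k)) n) with (pB (S (S k)) n).
change (theta (pB k) n) with (pB (S k) n).
assert (H := pB_l (S n) k).
change (bt (S n) (fun i => pB k (S i)))
  with (bt n (fun i => pB k (S i)) + bt n (fun i => pB k (S (S i)))) in H.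
rewrite pB_l in H.
unfold theta at 1; lra.
Qed.

Lemma pB_0_r (k : nat) : pB k O = 1.
Proof. induction k; simpl; [reflexivity|unfold theta; simpl; lra]. Qed.

Lemma bt_sub (n : nat) (f g h : nat -> R) :
  bt n (fun i => f i - g i + h i) = bt n f - bt n g + bt n h.
Proof.
rewrite (bt_ext n _ (fun i => 1 * (1 * f i + (-1) * g i) + 1 * h i))
  by (intros; ring).
rewrite bt_lin, (bt_lin n 1 (-1)); ring.
Qed.

(** With [E = 1 / (e^-a + e^-b - 1)], this is the coefficient form of
    [(4 - e^(a+b)) (E_a + E_b) - 4 E = (d_a - d_b) ((e^a - e^b) E)], whose
    right-hand side telescopes along antidiagonals. *)
Lemma pB_telescope (n k : nat) :
  let P n k := pB k (S n) + pB (S k) n in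
  let L n k := bt n (fun i => pB k i) - bt k (fun j => pB j n) in
  4 * P n k - bt n (fun i => bt k (fun j => P i j)) - 4 * pB k n
  = L (S n) k - L n (S k).
Proof.
intros P L.
assert (E : bt n (fun i => bt k (fun j => P i j))
  = bt k (fun j => bt n (fun i => pB j (S i)))
    + bt n (fun i => bt k (fun j => pB (S j) i))).
{ rewrite (bt_switch k n (fun j i => pB j (S i))).
  transitivity (1 * bt n (fun i => bt k (fun j => pB j (S i)))
   + 1 * bt n (fun i => bt k (fun j => pB (S j) i))); [|ring].
  rewrite <- bt_lin; apply bt_ext; intros i.
  transitivity (1 * bt k (fun j => pB j (S i)) + 1 * bt k (fun j => pB (S j) i)); [|ring].
  rewrite <- bt_lin; apply bt_ext; intros j; unfold P; ring. }
rewrite (bt_ext k (fun j => bt n (fun i => pB j (S i)))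
  (fun j => pB (S j) n - pB j n + pB j (S n))) in E
  by (intros; apply pB_l).
rewrite (bt_ext n (fun i => bt k (fun j => pB (S j) i))
  (fun i => pB k (S i) - pB k i + pB (S k) i)) in E
  by (intros; apply pB_r).
rewrite !bt_sub, pB_l, pB_r in E; rewrite E.
unfold L, P; cbn [bt]; rewrite pB_l, pB_r.
change (fun i => pB k i) with (pB k); change (fun i => pB (S k) i) with (pB (S k)); ring.
Qed.

(** Sum of [pB_telescope] over n + k = N. The right-hand side collapses to two boundary values, and
    their powers of 2 cancel against the transform of the constant -2. *)
Lemma ad_pB_rec (N : nat) :
  let b N := ad N (fun n k => pB k n) in
  4 * b (S N) - bt (S N) b = 3 + 2 * b N.
Proof.
intros b.
set (P := fun n k => pB k (S n) + pB (S k) n).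
set (L := fun n k => bt n (fun i => pB k i) - bt k (fun j => pB j n)).
assert (Hb : forall M, ad M P = 2 * b (S M) - 2).
{ intros M; unfold P.
  rewrite (ad_ext M _ (fun n k => 1 * pB k (S n) + 1 * pB (S k) n))
    by (intros; ring).
  rewrite (ad_lin M 1 1 (fun n k => pB k (S n)) (fun n k => pB (S k) n)).
  assert (E1 : b (S M) = ad M (fun n k => pB k (S n)) + pB (S M) O) by reflexivity.
  assert (E2 : b (S M) = ad M (fun n k => pB (S k) n) + pB O (S M))
    by apply (ad_S_r M (fun n k => pB k n)).
  rewrite pB_0_r in E1; change (pB O (S M)) with 1 in E2; lra. }
assert (E : ad N (fun n k => 4 * P n k - bt n (fun i => bt k (fun j => P i j))
                             - 4 * pB k n)
            = L (S N) O - L O (S N)).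
{ rewrite (ad_ext N _ (fun n k => 1 * L (S n) k + (-1) * L n (S k)))
    by (intros n k; unfold P, L; rewrite pB_telescope; ring).
  rewrite (ad_lin N 1 (-1) (fun n k => L (S n) k) (fun n k => L n (S k))).
  assert (E1 : ad (S N) L = ad N (fun n k => L (S n) k) + L O (S N)) by reflexivity.
  rewrite ad_S_r in E1; lra. }
rewrite (ad_ext N _ (fun n k => 1 * (4 * P n k +
   (-1) * bt n (fun i => bt k (fun j => P i j))) + (-4) * pB k n)) in E
  by (intros; ring).
rewrite ad_lin, ad_lin, ad_bt, Hb in E.
(* The entry 0 that [ad_bt] puts at index 0 fits the same formula, since [b 0 = 1]. *)
rewrite (bt_ext (S N) _ (fun m => 2 * b m + (-2) * 1)) in E.
2:{ intros [|M]; [unfold b; simpl; lra|rewrite Hb; ring]. }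
rewrite bt_lin, bt_1 in E.
assert (L1 : L (S N) O = 2 ^ S N - 1).
{ unfold L; change (bt 0 _) with 1.
  rewrite (bt_ext _ _ (fun _ => 1)), bt_1; reflexivity. }
assert (L2 : L O (S N) = 1 - 2 ^ S N).
{ unfold L; change (bt 0 _) with (pB (S N) O); rewrite pB_0_r.
  rewrite (bt_ext _ _ (fun _ => 1)), bt_1; [reflexivity|apply pB_0_r]. }
fold (b N) in E; rewrite L1, L2 in E.
clearbody b; clear - E; set (t := 2 ^ S N) in E; clearbody t; lra.
Qed.

(** With the top term of the transform isolated, the newest term has coefficient 4 - 1 = 3, so each
    value is determined by the earlier ones. *)
Lemma binomial_rec_unique (b c : nat -> R) :
  b O = c O ->
  (forall N, 4 * b (S N) - bt (S N) b = 3 + 2 * b N) ->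
  (forall N, 4 * c (S N) - bt (S N) c = 3 + 2 * c N) ->
  forall n, b n = c n.
Proof.
intros H0 Hb Hc n; induction n as [n IH] using (well_founded_induction lt_wf).
destruct n as [|n]; [exact H0|].
assert (H := bt_top (S n) b c IH).
specialize (Hb n); specialize (Hc n); rewrite (IH n) in Hb by lia; lra.
Qed.

(** * Generating functions as finite sums of exponentials *)

(** The list [l] of pairs [(c, j)] encodes [sum c e^(j t)]; [esum n l t] is the
    [n]-th derivative of this sum. *)
Fixpoint esum (n : nat) (l : list (R * nat)) (t : R) : R :=
  match l with
  | nil => 0
  | cons (c, j) l' => c * INR j ^ n * exp (INR j * t) + esum n l' t
  end.

(** The operator f + (e^t - 1) f' on such sums: c e^(j t) becomes c e^(j t) + c j e^((j+1) t) - c j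
    e^(j t). *)
Fixpoint estep (l : list (R * nat)) : list (R * nat) :=
  match l with
  | nil => nil
  | cons (c, j) l' =>
      cons (c, j) (cons (c * INR j, S j) (cons (- (c * INR j), j) (estep l')))
  end.

Lemma esum_step (l : list (R * nat)) (t : R) :
  esum 0 (estep l) t = esum 0 l t + (exp t - 1) * esum 1 l t.
Proof.
induction l as [|[c j] l IH]; [simpl; ring|].
cbn [esum estep]; rewrite IH, S_INR, Rmult_plus_distr_r, Rmult_1_l, exp_plus.
ring.
Qed.

Lemma bt_pow (n : nat) (a x : R) :
  bt n (fun i => a * x ^ i) = a * (1 + x) ^ n.
Proof.
revert a; induction n as [|n IH]; intros a; [simpl; ring|].
cbn [bt]; rewrite IH.
rewrite (bt_ext n _ (fun i => a * x * x ^ i)) by (intros; simpl; ring).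
rewrite IH; simpl; ring.
Qed.

Lemma bt_0 (n : nat) : bt n (fun _ => 0) = 0.
Proof. induction n as [|n IH]; simpl; [reflexivity|]; rewrite IH; ring. Qed.

Lemma esum_theta (l : list (R * nat)) (n : nat) :
  esum n (estep l) 0 = theta (fun i => esum i l 0) n.
Proof.
induction l as [|[c j] l IH].
  unfold theta; simpl; rewrite bt_0; ring.
cbn [esum estep]; rewrite IH.
rewrite (theta_ext (fun i => c * INR j ^ i * exp (INR j * 0) + esum i l 0)
   (fun i => c * INR j ^ i + 1 * esum i l 0))
  by (intros; rewrite Rmult_0_r, exp_0; ring).
rewrite (theta_lin c 1 (fun i => INR j ^ i) (fun i => esum i l 0)).
unfold theta at 2.
rewrite (bt_ext n _ (fun i => INR j * INR j ^ i)) by reflexivity.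
rewrite bt_pow, !Rmult_0_r, exp_0, S_INR; simpl pow.
rewrite (Rplus_comm (INR j) 1); ring.
Qed.

Lemma is_derive_esum (n : nat) (l : list (R * nat)) (t : R) :
  is_derive (esum n l) t (esum (S n) l t).
Proof.
induction l as [|[c j] l IH]; simpl; [auto_derive; reflexivity|].
apply (is_derive_plus (V := R_NormedModule)); [|exact IH].
auto_derive; [trivial|ring].
Qed.

Lemma is_pseries_esum (l : list (R * nat)) (t : R) :
  is_pseries (fun n => esum n l 0 / INR (fact n)) t (esum 0 l t).
Proof.
induction l as [|[c j] l IH].
  apply is_pseries_ext with (fun _ => 0); [intros; simpl; lra|].
  apply is_pseries_R, (is_series_ext (fun _ => 0)).
    intros n; symmetry; apply Rmult_0_l.
  apply filterlim_ext with (fun _ => 0); [|apply filterlim_const].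
  intros n; rewrite sum_n_const; simpl; ring.
cbn [esum].
apply is_pseries_ext with
  (PS_plus (fun n => scal c (INR j ^ n / INR (fact n)))
           (fun n => esum n l 0 / INR (fact n))).
  intros n; unfold PS_plus, plus, scal; simpl; unfold mult; simpl.
  rewrite Rmult_0_r, exp_0; field; apply INR_fact_neq_0.
apply (is_pseries_plus (V := R_NormedModule)); [|exact IH].
replace (c * INR j ^ 0 * exp (INR j * t)) with (scal c (exp (INR j * t)))
  by (unfold scal; simpl; unfold mult; simpl; ring).
apply (is_pseries_scal (V := R_NormedModule)); [apply Rmult_comm|].
assert (H := is_exp_Reals (INR j * t)).
apply is_pseries_R; apply is_pseries_R in H; revert H; apply is_series_ext.
intros n; simpl; rewrite Rpow_mult_distr; apply Rminus_diag_uniq; field; apply INR_fact_neq_0.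
Qed.

(** The exponentials in [Li_(-k)(1 - e^-t) / (1 - e^-t)]. *)
Fixpoint elist (k : nat) : list (R * nat) :=
  match k with
  | O => cons (1, 1%nat) nil
  | S k' => estep (elist k')
  end.

Lemma esum_elist (k n : nat) : esum n (elist k) 0 = pB k n.
Proof.
revert n; induction k as [|k IH]; intros n.
  simpl; rewrite Rmult_0_r, exp_0, pow1; ring.
simpl; rewrite esum_theta; apply theta_ext, IH.
Qed.

(** The coefficients of Li_(-k)(z) / z. *)
Definition powers (k m : nat) : R := (INR (S m)) ^ k.

Lemma powers_S (k m : nat) :
  powers (S k) m = PS_derive (PS_incr_1 (powers k)) m.
Proof. unfold powers, PS_derive, PS_incr_1; simpl pow; reflexivity. Qed.

Lemma CV_radius_powers (k : nat) : CV_radius (powers k) = 1.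
Proof.
induction k as [|k IH].
  rewrite <- Rinv_1; apply CV_radius_finite_DAlembert.
  - intros n; unfold powers; simpl; lra.
  - lra.
  - apply is_lim_seq_ext with (fun _ => 1); [|apply is_lim_seq_const].
    intros n; unfold powers; simpl; rewrite Rdiv_diag, Rabs_R1; lra.
rewrite (CV_radius_ext _ _ (powers_S k)), CV_radius_derive, CV_radius_incr_1.
exact IH.
Qed.

(** If F_k is the series of [powers k], then F_(k+1) = (z F_k)'. Along z = 1 - e^-t this is F_k +
    (e^t - 1) dF_k/dt, the operation of [estep]. The induction computes the t-derivative of z F_k in
    two ways and cancels dz/dt = e^-t; the base case is the geometric series 1/(1 - z) = e^t. *)
Lemma PSeries_powers (k : nat) (t : R) : Rabs (1 - exp (- t)) < 1 ->
  PSeries (powers k) (1 - exp (- t)) = esum 0 (elist k) t.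
Proof.
(* The induction hypothesis is differentiated, so it has to hold on a neighbourhood. *)
assert (Hopen : forall t, Rabs (1 - exp (- t)) < 1 ->
  locally t (fun t => Rabs (1 - exp (- t)) < 1)).
{ intros u Hu.
  apply (locally_open (fun u => Rabs (1 - exp (- u)) < 1)
           (fun u => Rabs (1 - exp (- u)) < 1)); [|auto|exact Hu].
  apply (open_comp (fun u => Rabs (1 - exp (- u))) (fun z => z < 1)).
    intros x _.
    apply (continuous_comp (fun u => 1 - exp (- u)) Rabs); [|apply continuous_Rabs].
    apply (ex_derive_continuous (V := R_NormedModule)); auto_derive; trivial.
  apply open_lt. }
revert t; induction k as [|k IH]; intros t Ht.
  set (z := 1 - exp (- t)) in *.
  transitivity (/ (1 - z)).
    transitivity (Series (fun n => z ^ n)); [|apply Series_geom, Ht].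
    unfold PSeries; apply Series_ext; intros n; unfold powers; simpl; ring.
  unfold z; simpl; rewrite !Rmult_1_l, Rplus_0_r.
  replace (1 - (1 - exp (- t))) with (exp (- t)) by ring.
  rewrite exp_Ropp, Rinv_inv; reflexivity.
rewrite (PSeries_ext _ _ _ (powers_S k)).
simpl elist; rewrite esum_step.
assert (HR : Rbar_lt (Rabs (1 - exp (- t))) (CV_radius (PS_incr_1 (powers k)))).
{ rewrite CV_radius_incr_1, CV_radius_powers; exact Ht. }
assert (D1 : is_derive (fun t => PSeries (PS_incr_1 (powers k)) (1 - exp (- t))) t
  (exp (- t) * PSeries (PS_derive (PS_incr_1 (powers k))) (1 - exp (- t)))).
{ apply (is_derive_comp (V := R_NormedModule)).
    apply is_derive_PSeries, HR.
  auto_derive; [trivial|ring]. }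
assert (D2 : is_derive (fun t => PSeries (PS_incr_1 (powers k)) (1 - exp (- t))) t
  (exp (- t) * esum 0 (elist k) t + (1 - exp (- t)) * esum 1 (elist k) t)).
{ apply (is_derive_ext_loc (fun t => (1 - exp (- t)) * esum 0 (elist k) t)).
    refine (filter_imp _ _ _ (Hopen t Ht)).
    intros u Hu; rewrite PSeries_incr_1, IH; [reflexivity|exact Hu].
  apply (is_derive_mult (fun t => 1 - exp (- t)) (esum 0 (elist k)) t
           (exp (- t)) (esum 1 (elist k) t)).
  - auto_derive; [trivial|ring].
  - apply is_derive_esum.
  - exact Rmult_comm. }
apply is_derive_unique in D1; apply is_derive_unique in D2.
rewrite D1 in D2.
apply Rmult_eq_reg_l with (exp (- t)); [|apply Rgt_not_eq, exp_pos].
rewrite D2, exp_Ropp; field; apply Rgt_not_eq, exp_pos.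
Qed.

Lemma Li_powers (k : nat) (z : R) : z <> 0 ->
  Li (- Z.of_nat k) z / z = PSeries (powers k) z.
Proof.
intros Hz; unfold Li, PSeries, Rdiv.
rewrite <- Series_scal_r; apply Series_ext; intros m.
unfold powers; rewrite powerRZ_neg', <- pow_powerRZ, Rinv_inv.
simpl; field; exact Hz.
Qed.

Lemma egf_pB (k : nat) : poly_bernoulli_egf (- Z.of_nat k) (pB k).
Proof.
(* For |t| < 1/2 one has e^-t < e^(1/2) < 2, because e <= 3 < 4; hence |1 - e^-t| < 1. *)
exists (mkposreal _ (Rinv_0_lt_compat 2 Rlt_0_2)).
intros t Ht Ht0; unfold ball in Ht; simpl in Ht.
unfold AbsRing_ball, abs, minus, plus, opp in Ht; simpl in Ht.
rewrite Ropp_0, Rplus_0_r in Ht.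
assert (Hz : Rabs (1 - exp (- t)) < 1).
{ apply Rabs_def2 in Ht.
  assert (exp (- t) < 2).
  { apply Rlt_le_trans with (exp (/ 2)); [apply exp_increasing; lra|].
    assert (exp (/ 2) * exp (/ 2) <= 3).
    { rewrite <- exp_plus; replace (/ 2 + / 2) with 1 by lra; apply exp_le_3. }
    assert (Hp := exp_pos (/ 2)); nra. }
  apply Rabs_def1; [|lra]; assert (Hp := exp_pos (- t)); lra. }
rewrite Li_powers, PSeries_powers; [|exact Hz|].
  apply is_pseries_ext with (fun n => esum n (elist k) 0 / INR (fact n)).
    intros n; rewrite esum_elist; reflexivity.
  apply is_pseries_esum.
intros E; apply Ht0, Ropp_eq_reg, exp_inv; rewrite Ropp_0, exp_0; lra.
Qed.

Lemma CV_radius_pos (a : nat -> R) (x : R) :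
  x <> 0 -> ex_pseries a x -> Rbar_lt 0 (CV_radius a).
Proof.
intros Hx Ha; destruct (Rbar_lt_le_dec 0 (CV_radius a)) as [H|H]; [exact H|].
exfalso; apply (CV_disk_outside a x).
  apply Rbar_le_lt_trans with 0; [exact H|apply Rabs_pos_lt, Hx].
apply ex_series_lim_0.
apply ex_pseries_R, Ha.
Qed.

Lemma egf_unique (k : Z) (A B : nat -> R) :
  poly_bernoulli_egf k A -> poly_bernoulli_egf k B -> forall n, A n = B n.
Proof.
intros [e1 H1] [e2 H2] n.
assert (Hb : forall t, Rabs t < Rmin e1 e2 -> ball 0 e1 t /\ ball 0 e2 t).
{ intros t Ht; unfold ball; simpl; unfold AbsRing_ball, abs, minus, plus, opp; simpl.
  rewrite Ropp_0, Rplus_0_r.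
  assert (H3 := Rmin_l e1 e2); assert (H4 := Rmin_r e1 e2); lra. }
assert (He : 0 < Rmin e1 e2) by (apply Rmin_pos; apply cond_pos).
set (t := Rmin e1 e2 / 2).
assert (Ht : Rabs t < Rmin e1 e2) by (rewrite Rabs_right; unfold t; lra).
assert (Ht0 : t <> 0) by (unfold t; lra).
destruct (Hb t Ht) as [B1 B2].
(* Multiplying by [t] makes the two series agree at the excluded point 0. *)
assert (E : A n / INR (fact n) = B n / INR (fact n)).
{ set (a := fun n => A n / INR (fact n)) in *.
  set (b := fun n => B n / INR (fact n)) in *.
  change (PS_incr_1 a (S n) = PS_incr_1 b (S n)).
  apply PSeries_ext_recip.
  - rewrite CV_radius_incr_1; apply CV_radius_pos with t;
      [exact Ht0|eexists; apply H1; auto].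
  - rewrite CV_radius_incr_1; apply CV_radius_pos with t;
      [exact Ht0|eexists; apply H2; auto].
  - exists (mkposreal _ He); intros u Hu.
    unfold ball in Hu; simpl in Hu.
    unfold AbsRing_ball, abs, minus, plus, opp in Hu; simpl in Hu.
    rewrite Ropp_0, Rplus_0_r in Hu; destruct (Hb u Hu) as [U1 U2].
    rewrite !PSeries_incr_1.
    destruct (Req_dec u 0) as [->|Hu0]; [ring|f_equal].
    rewrite (is_pseries_unique _ _ _ (H1 u U1 Hu0)).
    symmetry; apply is_pseries_unique, (H2 u U2 Hu0). }
apply (f_equal (fun x => x * INR (fact n))) in E.
unfold Rdiv in E; rewrite !Rmult_assoc, !Rinv_l in E by apply INR_fact_neq_0.
lra.
Qed.

(** The choice operator returns some sequence with the right generating function, since [pB k] is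
    one; uniqueness of coefficients identifies the two. *)
Lemma poly_bernoulli_pB (k n : nat) : poly_bernoulli (- Z.of_nat k) n = pB k n.
Proof.
apply (egf_unique (- Z.of_nat k)); [|apply egf_pB].
unfold poly_bernoulli; apply epsilon_spec.
exists (pB k); apply egf_pB.
Qed.

(** * The power series [sum r_j w^(j+1)] *)

(** The Taylor coefficients of [R(w) = (2 arcsin w - s) / sqrt (1 - w^2)], the
    solution of [(1 - w^2) R' - w R = 2] with [R(0) = -s]. *)
Fixpoint rc (s : R) (j : nat) : R :=
  match j with
  | O => - s
  | S O => 2
  | S (S i) => INR (S i) / INR (S (S i)) * rc s i
  end.

Lemma rc_bound (s : R) (j : nat) : Rabs (rc s j) <= Rabs s + 2.
Proof.
assert (Hs := Rabs_pos s).
enough (H : Rabs (rc s j) <= Rabs s + 2 /\ Rabs (rc s (S j)) <= Rabs s + 2)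
  by apply H.
induction j as [|j [IH1 IH2]].
  split; simpl; [rewrite Rabs_Ropp|rewrite Rabs_pos_eq]; lra.
split; [exact IH2|].
change (rc s (S (S j))) with (INR (S j) / INR (S (S j)) * rc s j).
rewrite Rabs_mult; apply Rle_trans with (1 * Rabs (rc s j)); [|lra].
apply Rmult_le_compat_r; [apply Rabs_pos|].
assert (H1 := lt_0_INR (S j) (Nat.lt_0_succ j)).
rewrite (S_INR (S j)), Rabs_pos_eq.
  apply Rmult_le_reg_r with (INR (S j) + 1); [lra|].
  unfold Rdiv; rewrite Rmult_assoc, Rinv_l; lra.
apply Rlt_le, Rdiv_lt_0_compat; lra.
Qed.

(** The coefficients after applying [(w/2) d/dw] [m] times to
    [sum_j rc s j * w^(j+1)], up to the index shift. *)
Definition pc (s : R) (m j : nat) : R := rc s j * (INR (S j) / 2) ^ m.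

Lemma pc_S (s : R) (m j : nat) :
  pc s (S m) j = PS_scal (/ 2) (PS_derive (PS_incr_1 (pc s m))) j.
Proof.
unfold pc, PS_scal, PS_derive, PS_incr_1, scal; simpl; unfold mult; simpl.
field.
Qed.

Lemma CV_radius_pc (s : R) (m : nat) (w : R) :
  Rabs w < 1 -> Rbar_lt (Rabs w) (CV_radius (pc s m)).
Proof.
intros Hw; apply Rbar_lt_le_trans with 1; [exact Hw|].
induction m as [|m IH].
  apply (proj1 (CV_radius_bounded (pc s 0))).
  exists (Rabs s + 2); intros n; unfold pc; simpl pow.
  rewrite pow1, !Rmult_1_r; apply rc_bound.
rewrite (CV_radius_ext _ _ (pc_S s m)), CV_radius_scal, CV_radius_derive,
  CV_radius_incr_1; [exact IH|lra].
Qed.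

Lemma half_trig_bounds (t : R) : 0 < t < PI ->
  0 < sin (t / 2) < 1 /\ 0 < cos (t / 2).
Proof.
intros Ht.
assert (H1 : 0 < sin (t / 2)) by (apply sin_gt_0; lra).
assert (H2 : 0 < cos (t / 2)) by (apply cos_gt_0; lra).
assert (H3 := sin2_cos2 (t / 2)); unfold Rsqr in H3.
split; [split|]; nra.
Qed.

Lemma abs_sin_lt_1 (t : R) : - PI < t < PI -> Rabs (sin (t / 2)) < 1.
Proof.
intros Ht.
assert (H2 : 0 < cos (t / 2)) by (apply cos_gt_0; lra).
assert (H3 := sin2_cos2 (t / 2)); unfold Rsqr in H3.
apply Rabs_def1; nra.
Qed.

(** The recurrence (j+2) r_(j+2) = (j+1) r_j with r_1 = 2 says R' = 2 + w (w R)'. *)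
Lemma rc_ode (s w : R) : Rabs w < 1 ->
  PSeries (PS_derive (rc s)) w
  = 2 + w * PSeries (rc s) w + w ^ 2 * PSeries (PS_derive (rc s)) w.
Proof.
intros Hw.
assert (HR : Rbar_lt (Rabs w) (CV_radius (rc s))).
{ rewrite (CV_radius_ext (rc s) (pc s 0)) by (intros; unfold pc; simpl; ring).
  apply CV_radius_pc, Hw. }
assert (E : PSeries (PS_derive (PS_incr_1 (rc s))) w
            = PSeries (rc s) w + w * PSeries (PS_derive (rc s)) w).
{ rewrite <- Derive_PSeries by (rewrite CV_radius_incr_1; exact HR).
  rewrite (Derive_ext _ (fun w => w * PSeries (rc s) w))
    by (intros; apply PSeries_incr_1).
  apply is_derive_unique.
  replace (PSeries (rc s) w + w * PSeries (PS_derive (rc s)) w)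
    with (1 * PSeries (rc s) w + w * PSeries (PS_derive (rc s)) w) by ring.
  apply (is_derive_mult (fun w => w) (PSeries (rc s))).
  - apply (is_derive_id (K := R_AbsRing)).
  - apply is_derive_PSeries, HR.
  - exact Rmult_comm. }
rewrite PSeries_decr_1 at 1
  by (apply CV_radius_inside; rewrite CV_radius_derive; exact HR).
rewrite (PSeries_ext (PS_decr_1 (PS_derive (rc s))) (PS_derive (PS_incr_1 (rc s)))).
  rewrite E; unfold PS_derive at 1; simpl; ring.
intros j; unfold PS_decr_1, PS_derive, PS_incr_1.
change (rc s (S (S j))) with (INR (S j) / INR (S (S j)) * rc s j).
field; apply not_0_INR; lia.
Qed.

(** By [rc_ode], the derivative of cos(t/2) R(sin(t/2)) is ((1 - w^2) R' - w R) / 2 = 1, and its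
    value at t = 0 is -s. The arcsine is thereby avoided. *)
Lemma PSeries_rc (s t : R) : 0 <= t < PI ->
  cos (t / 2) * PSeries (rc s) (sin (t / 2)) = t - s.
Proof.
intros Ht.
destruct (Req_dec t 0) as [->|H0].
  replace (0 / 2) with 0 by field.
  rewrite cos_0, sin_0, PSeries_0; simpl; ring.
set (f := fun t => cos (t / 2) * PSeries (rc s) (sin (t / 2)) - t).
assert (E : f 0 = f t).
{ apply (eq_is_derive (V := R_NormedModule) f); [|lra].
  intros u Hu; unfold f.
  assert (Hw : Rabs (sin (u / 2)) < 1) by (apply abs_sin_lt_1; lra).
  assert (HR : Rbar_lt (Rabs (sin (u / 2))) (CV_radius (rc s))).
  { rewrite (CV_radius_ext (rc s) (pc s 0)) by (intros; unfold pc; simpl; ring).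
    apply CV_radius_pc, Hw. }
  assert (E := rc_ode s _ Hw).
  assert (H3 := sin2_cos2 (u / 2)); unfold Rsqr in H3.
  evar_last.
    apply (is_derive_minus (V := R_NormedModule)); [|apply (is_derive_id (K := R_AbsRing))].
    apply (is_derive_mult (fun u => cos (u / 2)) (fun u => PSeries (rc s) (sin (u / 2))) u
      (- sin (u / 2) / 2) (cos (u / 2) / 2 * PSeries (PS_derive (rc s)) (sin (u / 2)))).
    - auto_derive; [trivial|unfold Rdiv; field].
    - apply (is_derive_comp (V := R_NormedModule) (PSeries (rc s)) (fun u => sin (u / 2))).
        apply is_derive_PSeries, HR.
      auto_derive; [trivial|unfold Rdiv; field].
    - exact Rmult_comm.
  unfold minus, plus, opp, mult, one, zero; simpl.
  set (W := PSeries (PS_derive (rc s)) (sin (u / 2))) in *.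
  set (V := PSeries (rc s) (sin (u / 2))) in *.
  assert (E' := f_equal (Rmult W) H3); lra. }
unfold f in E.
replace (0 / 2) with 0 in E by field.
rewrite cos_0, sin_0, PSeries_0 in E; simpl in E; lra.
Qed.

(** (tan(t/2) d/dt)^m applied to (t - s) tan(t/2), with s constant; [Psi_0] and [is_derive_Psi]
    justify this reading for 0 < t < PI. *)
Definition Psi (s : R) (m : nat) (t : R) : R :=
  PSeries (PS_incr_1 (pc s m)) (sin (t / 2)).

Lemma Psi_0 (s t : R) : 0 < t < PI ->
  Psi s 0 t = (t - s) * (sin (t / 2) / cos (t / 2)).
Proof.
intros Ht; unfold Psi; rewrite PSeries_incr_1.
rewrite <- (PSeries_rc s t) by lra.
rewrite (PSeries_ext _ (rc s)) by (intros; unfold pc; simpl; ring).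
destruct (half_trig_bounds t Ht); field; lra.
Qed.

Lemma is_derive_Psi (s : R) (m : nat) (t : R) : 0 < t < PI ->
  is_derive (Psi s m) t (cos (t / 2) / sin (t / 2) * Psi s (S m) t).
Proof.
intros Ht; destruct (half_trig_bounds t Ht) as [Hs Hc]; unfold Psi.
assert (Hw : Rabs (sin (t / 2)) < 1) by (apply abs_sin_lt_1; lra).
rewrite PSeries_incr_1, (PSeries_ext _ _ _ (pc_S s m)), PSeries_scal.
evar_last.
  apply (is_derive_comp (V := R_NormedModule) _ (fun t => sin (t / 2))).
    apply is_derive_PSeries; rewrite CV_radius_incr_1; apply CV_radius_pc, Hw.
  auto_derive; [trivial|reflexivity].
unfold scal; simpl; unfold mult; simpl.
change (t * / 2) with (t / 2); field; lra.
Qed.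

(** * Closed form of [Psi] in terms of [p] and [q] *)

(** [pq] is built with the total operator [Derive], so differentiability at every stage must be
    carried along. The constructor [polyfun_ext] allows [Derive f] to be exchanged with a pointwise
    equal polynomial. *)
Inductive polyfun : (R -> R) -> Prop :=
| polyfun_const c : polyfun (fun _ => c)
| polyfun_id : polyfun (fun x => x)
| polyfun_plus f g : polyfun f -> polyfun g -> polyfun (fun x => f x + g x)
| polyfun_mult f g : polyfun f -> polyfun g -> polyfun (fun x => f x * g x)
| polyfun_ext f g : polyfun f -> (forall x, f x = g x) -> polyfun g.

Lemma polyfun_derive (f : R -> R) : polyfun f ->
  exists g, polyfun g /\ forall x, is_derive f x (g x).
Proof.
induction 1 as [c| |f g Hf [f' [Pf Df]] Hg [g' [Pg Dg]]
  |f g Hf [f' [Pf Df]] Hg [g' [Pg Dg]]|f g Hf [f' [Pf Df]] E].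
- exists (fun _ => 0); split; [apply polyfun_const|intros; auto_derive; trivial].
- exists (fun _ => 1); split; [apply polyfun_const|intros; auto_derive; trivial].
- exists (fun x => f' x + g' x); split; [apply polyfun_plus; assumption|].
  intros x; apply (is_derive_plus (V := R_NormedModule)); auto.
- exists (fun x => f' x * g x + f x * g' x); split.
    apply polyfun_plus; apply polyfun_mult; assumption.
  intros x; apply (is_derive_mult f g); auto; exact Rmult_comm.
- exists f'; split; [assumption|].
  intros x; apply (is_derive_ext f); auto.
Qed.

Lemma polyfun_Derive (f : R -> R) : polyfun f ->
  polyfun (Derive f) /\ forall x, is_derive f x (Derive f x).
Proof.
intros H; destruct (polyfun_derive f H) as [g [Pg Dg]]; split.
  apply polyfun_ext with g; [exact Pg|].
  intros x; symmetry; apply is_derive_unique, Dg.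
intros x; apply Derive_correct; eexists; apply Dg.
Qed.

Lemma polyfun_pq (m : nat) : polyfun (fst (pq m)) /\ polyfun (snd (pq m)).
Proof.
induction m as [|m [IH1 IH2]]; [split; simpl; apply polyfun_const|].
simpl; destruct (pq m) as [P Q]; simpl in *.
destruct (polyfun_Derive P IH1) as [DP _].
destruct (polyfun_Derive Q IH2) as [DQ _].
assert (HN : forall f, polyfun f -> polyfun (fun x => 1 - f x)).
{ intros f Hf; apply polyfun_ext with (fun x => 1 + -1 * f x).
    repeat constructor; exact Hf.
  intros; ring. }
assert (H1 := HN _ polyfun_id).
split; repeat first [assumption | apply polyfun_plus | apply polyfun_mult
  | apply polyfun_const | apply polyfun_id].
Qed.

Lemma locally_0_PI (t : R) : 0 < t < PI -> locally t (fun t => 0 < t < PI).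
Proof.
intros Ht; apply (locally_interval _ t 0 PI); simpl; [apply Ht|apply Ht|].
intros y H1 H2; split; assumption.
Qed.

(** Induction on m by differentiating both sides in t at fixed s. The derivative of t - s in the
    second summand yields the [q_n] term in the recurrence of [p]. *)
Lemma Psi_pq (s : R) (m : nat) (t : R) : 0 < t < PI ->
  let x := sin (t / 2) ^ 2 in
  Psi s m t * (2 * (1 - x)) ^ m
  = 2 * x * fst (pq m) x
    + (t - s) * (sin (t / 2) / cos (t / 2)) * snd (pq m) x.
Proof.
revert t; induction m as [|m IH]; intros t Ht x.
  rewrite (Psi_0 s t Ht); simpl; ring.
destruct (half_trig_bounds t Ht) as [Hs Hc].
destruct (polyfun_pq m) as [HP HQ].
assert (IHt := IH t Ht).
change (pq (S m)) with (let n := IZR (Z.of_nat m - 1) in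
      let (p, q) := pq m in
      (fun x => 2 * (n * x + 1) * p x + 2 * x * (1 - x) * Derive p x + q x,
       fun x => (2 * (n + 1) * x + 1) * q x + 2 * x * (1 - x) * Derive q x)).
destruct (pq m) as [P Q]; cbn [fst snd] in *; fold x in IHt.
destruct (polyfun_Derive P HP) as [_ DP].
destruct (polyfun_Derive Q HQ) as [_ DQ].
set (S2 := fun t => sin (t / 2) ^ 2).
assert (DS : is_derive S2 t (sin (t / 2) * cos (t / 2)))
  by (unfold S2; auto_derive; [trivial|unfold Rdiv; field]).
assert (E1 : is_derive (fun t => Psi s m t * (2 * (1 - S2 t)) ^ m) t
  (cos (t / 2) / sin (t / 2) * Psi s (S m) t * (2 * (1 - x)) ^ m
   + Psi s m t * (INR m * (- 2 * (sin (t / 2) * cos (t / 2)))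
                  * (2 * (1 - x)) ^ pred m))).
{ apply (is_derive_mult (Psi s m) (fun t => (2 * (1 - S2 t)) ^ m)).
  - apply is_derive_Psi, Ht.
  - apply (is_derive_pow (fun t => 2 * (1 - S2 t))).
    evar_last.
      apply is_derive_scal; apply (is_derive_minus (V := R_NormedModule));
        [apply (is_derive_const (V := R_NormedModule))|exact DS].
    unfold minus, plus, opp, zero; simpl; ring.
  - exact Rmult_comm. }
assert (E2 : is_derive (fun t => Psi s m t * (2 * (1 - S2 t)) ^ m) t
  ((2 * (sin (t / 2) * cos (t / 2)) * P x
    + 2 * x * (sin (t / 2) * cos (t / 2) * Derive P x))
   + ((sin (t / 2) / cos (t / 2) + (t - s) / (2 * cos (t / 2) ^ 2)) * Q x
      + (t - s) * (sin (t / 2) / cos (t / 2))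
        * (sin (t / 2) * cos (t / 2) * Derive Q x)))).
{ apply (is_derive_ext_loc (fun t => 2 * S2 t * P (S2 t)
    + (t - s) * (sin (t / 2) / cos (t / 2)) * Q (S2 t))).
    refine (filter_imp _ _ _ (locally_0_PI t Ht)).
    intros u Hu; symmetry; apply (IH u Hu).
  apply (is_derive_plus (V := R_NormedModule)).
    apply (is_derive_mult (fun t => 2 * S2 t) (fun t => P (S2 t))).
    - apply is_derive_scal, DS.
    - apply (is_derive_comp (V := R_NormedModule) P S2); [apply DP|exact DS].
    - exact Rmult_comm.
  apply (is_derive_mult (fun t => (t - s) * (sin (t / 2) / cos (t / 2)))
           (fun t => Q (S2 t))).
  - auto_derive; [lra|].
    assert (H3 := sin2_cos2 (t / 2)); unfold Rsqr in H3.
    apply Rminus_diag_uniq.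
    replace (t * / 2) with (t / 2) by reflexivity.
    set (c := cos (t / 2)) in *; set (S := sin (t / 2)) in *.
    transitivity ((t - s) * (S * S + c * c - 1) / (2 * c ^ 2)); [field; lra|].
    rewrite H3; field; lra.
  - apply (is_derive_comp (V := R_NormedModule) Q S2); [apply DQ|exact DS].
  - exact Rmult_comm. }
apply is_derive_unique in E1; apply is_derive_unique in E2; rewrite E1 in E2.

clear E1 DS DP DQ HP HQ IH.
rewrite minus_IZR, <- INR_IZR_INZ.
(* The factor [INR m] makes this true also at m = 0, where [pred 0 = 0]. *)
assert (HX : INR m * (2 * (1 - x)) ^ pred m * (2 * (1 - x))
             = INR m * (2 * (1 - x)) ^ m) by (destruct m; simpl; ring).
assert (Hx : 1 - x = cos (t / 2) ^ 2).
{ assert (H3 := sin2_cos2 (t / 2)); unfold Rsqr in H3; unfold x; simpl; lra. }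
rewrite Hx in *.
replace (2 * ((INR m - 1) * x + 1)) with (2 * (INR m * x + (1 - x))) by ring.
rewrite Hx; clear Hx.
change ((2 * cos (t / 2) ^ 2) ^ S m) with
  (2 * cos (t / 2) ^ 2 * (2 * cos (t / 2) ^ 2) ^ m).
set (K := (2 * cos (t / 2) ^ 2) ^ pred m) in *.
set (Xm := (2 * cos (t / 2) ^ 2) ^ m) in *.
set (c := cos (t / 2)) in *; set (S := sin (t / 2)) in *.
set (a := Psi s (Datatypes.S m) t) in *; set (b := Psi s m t) in *.
(* The differentiated identity is multiplied by 2 sin cos; the added term cancels the contribution
   of the derivative of (2 (1 - x))^m. *)
transitivity (2 * S * c * (c / S * a * Xm + b * (INR m * (- 2 * (S * c)) * K))
  + 2 * x * (b * (INR m * K * (2 * c ^ 2)))); [unfold x; field; lra|].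
rewrite HX, E2.
transitivity (2 * S * c * (2 * (S * c) * P x + 2 * x * (S * c * Derive P x)
 + ((S / c + (t - s) / (2 * c ^ 2)) * Q x + (t - s) * (S / c) * (S * c * Derive Q x)))
  + 2 * x * INR m * (b * Xm)); [ring|].
rewrite IHt; set (Px := P x); set (Qx := Q x); set (Px' := Derive P x);
set (Qx' := Derive Q x); unfold x; field; lra.
Qed.

(** * The differential equation and the value at pi/3 *)

Lemma is_derive_bt (n : nat) (f : nat -> R -> R) (d : nat -> R) (t : R) :
  (forall i, is_derive (f i) t (d i)) ->
  is_derive (fun u => bt n (fun i => f i u)) t (bt n d).
Proof.
revert f d; induction n as [|n IH]; intros f d H; simpl; [apply H|].
apply (is_derive_plus (V := R_NormedModule)).
  apply IH, H.
apply (IH (fun i => f (S i))); intros i; apply H.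
Qed.

(** In the variable [u] with [e^u = 4 x], the function [G = Psi s 0] solves
    [(4 - e^u) G' = e^u + 2 G]; this is the [n]-th derivative of the equation. *)
Lemma Psi_bt (s : R) (n : nat) (t : R) : 0 < t < PI ->
  4 * Psi s (S n) t - 4 * sin (t / 2) ^ 2 * bt n (fun i => Psi s (S i) t)
  = 4 * sin (t / 2) ^ 2 + 2 * Psi s n t.
Proof.
revert t; induction n as [|n IH]; intros t Ht.
  (* Here p_0 = q_0 = 1, so the identity is 2 (1 - x) G' = 2 x + G, half of the equation. *)
  assert (E1 := Psi_pq s 1 t Ht); simpl in E1; rewrite !Derive_const in E1.
  simpl bt; rewrite (Psi_0 s t Ht).
  set (T := (t - s) * (sin (t / 2) / cos (t / 2))) in *.
  simpl; lra.
destruct (half_trig_bounds t Ht) as [Hs Hc].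
set (k := cos (t / 2) / sin (t / 2)).
assert (E1 : is_derive (fun t => 4 * Psi s (S n) t
   - 4 * sin (t / 2) ^ 2 * bt n (fun i => Psi s (S i) t)) t
  (4 * (k * Psi s (S (S n)) t)
   - (4 * (sin (t / 2) * cos (t / 2)) * bt n (fun i => Psi s (S i) t)
      + 4 * sin (t / 2) ^ 2 * bt n (fun i => k * Psi s (S (S i)) t)))).
{ apply (is_derive_minus (V := R_NormedModule)).
    apply is_derive_scal, is_derive_Psi, Ht.
  apply (is_derive_mult (fun t => 4 * sin (t / 2) ^ 2)
           (fun t => bt n (fun i => Psi s (S i) t))).
  - auto_derive; [trivial|unfold Rdiv; field].
  - apply (is_derive_bt n (fun i => Psi s (S i))); intros i.
    apply is_derive_Psi, Ht.
  - exact Rmult_comm. }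
assert (E2 : is_derive (fun t => 4 * Psi s (S n) t
   - 4 * sin (t / 2) ^ 2 * bt n (fun i => Psi s (S i) t)) t
  (4 * (sin (t / 2) * cos (t / 2)) + 2 * (k * Psi s (S n) t))).
{ apply (is_derive_ext_loc (fun t => 4 * sin (t / 2) ^ 2 + 2 * Psi s n t)).
    refine (filter_imp _ _ _ (locally_0_PI t Ht)).
    intros u Hu; symmetry; apply (IH u Hu).
  apply (is_derive_plus (V := R_NormedModule)).
    auto_derive; [trivial|unfold Rdiv; field].
  apply is_derive_scal, is_derive_Psi, Ht. }
apply is_derive_unique in E1; apply is_derive_unique in E2; rewrite E1 in E2.
assert (Hk : sin (t / 2) * cos (t / 2) = k * sin (t / 2) ^ 2)
  by (unfold k; field; lra).
assert (Hk0 : k <> 0)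
  by (apply Rgt_not_eq, Rdiv_lt_0_compat; lra).
rewrite (bt_ext n (fun i => k * Psi s (S (S i)) t)
  (fun i => k * Psi s (S (S i)) t + 0 * 0)) in E2
  by (intros; ring).
rewrite (bt_lin n k 0 (fun i => Psi s (S (S i)) t) (fun _ => 0)) in E2.
rewrite Hk in E2.
(* Every term carries k = du/dt. Dividing by it, the two summands of the product rule form
   [bt (S n)] by Pascal's rule. *)
apply Rmult_eq_reg_l with k; [|exact Hk0].
cbn [bt]; lra.
Qed.

Lemma Psi_PI3 (n : nat) :
  Psi (PI / 3) (S n) (PI / 3)
  = 1 / 3 * sum_f_R0 (fun k => poly_bernoulli (- Z.of_nat k) (n - k)%nat) n.
Proof.
assert (Hpi := PI_RGT_0).
assert (Ht : 0 < PI / 3 < PI) by lra.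
assert (E : forall N, 4 * Psi (PI / 3) (S N) (PI / 3)
   - bt N (fun i => Psi (PI / 3) (S i) (PI / 3)) = 1 + 2 * Psi (PI / 3) N (PI / 3)).
{ intros N; rewrite <- (Rmult_1_l (bt N _)).
  replace 1 with (4 * sin (PI / 3 / 2) ^ 2); [apply Psi_bt, Ht|].
  replace (PI / 3 / 2) with (PI / 6) by field; rewrite sin_PI6; field. }
assert (H : forall n, ad n (fun n k => pB k n) = 3 * Psi (PI / 3) (S n) (PI / 3)).
{ apply binomial_rec_unique.
  (* [Psi 0] vanishes at t = s, so E at 0 gives 3 Psi_1 = 1. For the recurrence itself E is used at
     N + 1, since index i of the sequence stands for Psi_(i+1). *)
  - assert (E0 := E 0%nat); rewrite (Psi_0 _ _ Ht) in E0; simpl in E0 |- *; lra.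
  - intros N; apply (ad_pB_rec N).
  - intros N.
    rewrite (bt_ext (S N) _ (fun i => 3 * Psi (PI / 3) (S i) (PI / 3) + 0 * 0))
      by (intros; ring).
    rewrite (bt_lin (S N) 3 0 (fun i => Psi (PI / 3) (S i) (PI / 3)) (fun _ => 0)).
    assert (EN := E (S N)); lra. }
rewrite (sum_eq _ (fun k => pB k (n - k)%nat))
  by (intros; apply poly_bernoulli_pB).
rewrite <- (ad_sum n (fun n k => pB k n)), H; field.
Qed.

(** * Series of complex exponentials are entire *)

Lemma abs_sin_le (x : R) : Rabs (sin x) <= Rabs x.
Proof.
assert (H : forall x, 0 < x -> Rabs (sin x) <= x).
{ intros y Hy; assert (H1 := sin_lt_x y Hy); assert (H2 := SIN_bound y).
  apply Rabs_le; split; [|lra].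
  destruct (Rle_dec y 3) as [H3|H3]; [|lra].
  assert (H4 := PI2_3_2); assert (0 <= sin y) by (apply sin_ge_0; lra); lra. }
destruct (Rtotal_order x 0) as [Hx|[->|Hx]].
- rewrite <- (Rabs_Ropp x), <- Rabs_Ropp, <- sin_neg.
  rewrite (Rabs_pos_eq (- x)) by lra; apply H; lra.
- rewrite sin_0; lra.
- rewrite (Rabs_pos_eq x) by lra; apply H, Hx.
Qed.

Lemma cos_half (x : R) : 1 - cos x = 2 * sin (x / 2) ^ 2.
Proof.
replace x with (2 * (x / 2)) at 1 by field; rewrite cos_2a_sin; ring.
Qed.

Lemma one_minus_cos_sq (x : R) : 1 - cos x <= x ^ 2 / 2.
Proof.
rewrite cos_half; assert (H := abs_sin_le (x / 2)).
apply Rsqr_le_abs_1 in H; unfold Rsqr in H; nra.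
Qed.

Lemma one_minus_cos_abs (x : R) : 1 - cos x <= Rabs x.
Proof.
rewrite cos_half; assert (H := abs_sin_le (x / 2)).
rewrite <- pow2_abs; unfold Rdiv in H at 2.
rewrite Rabs_mult, (Rabs_pos_eq (/ 2)) in H by lra.
assert (H0 := Rabs_pos (sin (x / 2))).
assert (H1 : Rabs (sin (x / 2)) <= 1)
  by (apply Rabs_le; assert (H1 := SIN_bound (x / 2)); lra).
nra.
Qed.

Lemma sin_sub_id (x : R) : Rabs (sin x - x) <= x ^ 2.
Proof.
destruct (MVT_gen (fun x => sin x - x) 0 x (fun x => cos x - 1)) as [c [Hc E]].
- intros y _; auto_derive; [trivial|ring].
- intros y _; apply continuity_pt_minus;
    [apply continuity_sin|apply continuity_pt_id].
- rewrite sin_0, !Rminus_0_r in E; rewrite E, Rabs_mult, <- pow2_abs.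
  assert (H : Rabs c <= Rabs x).
  { revert Hc; unfold Rmin, Rmax; destruct (Rle_dec 0 x); intros Hc.
      rewrite !Rabs_pos_eq; lra.
    rewrite (Rabs_left1 c), (Rabs_left1 x); lra. }
  assert (H1 : Rabs (cos c - 1) <= Rabs x).
  { rewrite Rabs_left1.
      assert (H1 := one_minus_cos_abs c); lra.
    assert (H1 := COS_bound c); lra. }
  assert (H0 := Rabs_pos x); nra.
Qed.

Lemma exp_sub_1 (a : R) : Rabs (exp a - 1) <= Rabs a * exp (Rabs a).
Proof.
assert (H1 := exp_ineq1_le a); assert (H2 := exp_ineq1_le (- a)).
assert (H3 := exp_pos a).
assert (H4 : exp a * exp (- a) = 1) by (rewrite <- exp_plus, Rplus_opp_r; apply exp_0).
destruct (Rle_dec 0 a) as [Ha|Ha].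
  rewrite (Rabs_pos_eq a Ha), Rabs_pos_eq by lra; nra.
rewrite (Rabs_left a), Rabs_left1 by nra; nra.
Qed.

Lemma exp_sub_1_id (a : R) : Rabs (exp a - 1 - a) <= a ^ 2 * exp (Rabs a).
Proof.
assert (H1 := exp_ineq1_le a); assert (H2 := exp_ineq1_le (- a)).
assert (H3 := exp_pos a).
assert (H4 : exp a * exp (- a) = 1) by (rewrite <- exp_plus, Rplus_opp_r; apply exp_0).
rewrite Rabs_pos_eq by lra.
assert (H5 : exp a - 1 - a <= a * (exp a - 1)) by nra.
apply Rle_trans with (1 := H5).
apply Rle_trans with (Rabs (a * (exp a - 1))); [apply Rle_abs|].
rewrite Rabs_mult, <- pow2_abs.
replace (Rabs a ^ 2 * exp (Rabs a)) with (Rabs a * (Rabs a * exp (Rabs a))) by ring.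
apply Rmult_le_compat_l; [apply Rabs_pos|apply exp_sub_1].
Qed.

Lemma exp_le (x y : R) : x <= y -> exp x <= exp y.
Proof.
intros [H| ->]; [apply Rlt_le, exp_increasing, H|apply Rle_refl].
Qed.

Lemma Cexp_plus (z w : C) : Cexp (z + w) = (Cexp z * Cexp w)%C.
Proof.
unfold Cexp; destruct z as [a b], w as [c d]; simpl.
rewrite exp_plus, cos_plus, sin_plus.
unfold Cmult; simpl; f_equal; ring.
Qed.

Lemma Cmod_Cexp (z : C) : Cmod (Cexp z) = exp (Re z).
Proof.
unfold Cexp, Cmod; simpl.
assert (H := sin2_cos2 (Im z)); unfold Rsqr in H.
transitivity (sqrt (exp (Re z) ^ 2)); [|apply sqrt_pow2, Rlt_le, exp_pos].
f_equal; transitivity (exp (Re z) ^ 2 * (sin (Im z) * sin (Im z)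
  + cos (Im z) * cos (Im z))); [ring|rewrite H; ring].
Qed.

Lemma Cmod_le_abs (z : C) : Cmod z <= Rabs (Re z) + Rabs (Im z).
Proof.
destruct z as [a b]; simpl.
replace (a, b) with (RtoC a + Ci * RtoC b)%C
  by (unfold Ci, RtoC, Cplus, Cmult; simpl; f_equal; ring).
eapply Rle_trans; [apply Cmod_triangle|].
rewrite Cmod_mult, Cmod_Ci, !Cmod_R; lra.
Qed.

Lemma abs_Im_le_Cmod (z : C) : Rabs (Im z) <= Cmod z.
Proof.
eapply Rle_trans; [|apply Rmax_Cmod]; apply Rmax_r.
Qed.

(** The constant 4 counts two error terms in each of the real and imaginary parts, each at most
    |w|^2 e^|w|. *)
Lemma Cexp_second_order (w : C) :
  Cmod (Cexp w - 1 - w)%C <= 4 * Cmod w ^ 2 * exp (Cmod w).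
Proof.
set (m := Cmod w).
assert (Ha : Rabs (Re w) <= m) by apply re_le_Cmod.
assert (Hb : Rabs (Im w) <= m) by apply abs_Im_le_Cmod.
destruct w as [a b]; simpl in Ha, Hb.
eapply Rle_trans; [apply Cmod_le_abs|]; simpl.
assert (Ha0 := Rabs_pos a); assert (Hb0 := Rabs_pos b).
assert (Ea : exp (Rabs a) <= exp m) by apply exp_le, Ha.
assert (Ea' : exp a <= exp m) by (apply exp_le; assert (H := Rle_abs a); lra).
assert (Ep := exp_pos a); assert (Eq := exp_pos (Rabs a)).
assert (A2 : a ^ 2 <= m ^ 2) by (rewrite <- pow2_abs; nra).
assert (B2 : b ^ 2 <= m ^ 2) by (rewrite <- pow2_abs; nra).
assert (A0 : 0 <= a ^ 2) by apply pow2_ge_0.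
assert (B0 : 0 <= b ^ 2) by apply pow2_ge_0.
assert (I1 : Rabs (exp a - 1 - a) <= m ^ 2 * exp m)
  by (eapply Rle_trans; [apply exp_sub_1_id|]; apply Rmult_le_compat; lra).
assert (I2 : Rabs (exp a * (1 - cos b)) <= exp m * m ^ 2).
{ assert (H1 := one_minus_cos_sq b); assert (H2 := COS_bound b).
  rewrite Rabs_pos_eq by (apply Rmult_le_pos; lra).
  apply Rmult_le_compat; lra. }
assert (I3 : Rabs (exp a * (sin b - b)) <= exp m * m ^ 2).
{ rewrite Rabs_mult, (Rabs_pos_eq (exp a)) by lra.
  apply Rmult_le_compat; [lra|apply Rabs_pos|lra|].
  apply Rle_trans with (1 := sin_sub_id b); lra. }
assert (I4 : Rabs ((exp a - 1) * b) <= (m * exp m) * m).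
{ rewrite Rabs_mult; apply Rmult_le_compat; [apply Rabs_pos|lra| |lra].
  apply Rle_trans with (1 := exp_sub_1 a); apply Rmult_le_compat; lra. }
replace (exp a * cos b + - (1) + - a)
  with (exp a - 1 - a + - (exp a * (1 - cos b))) by ring.
replace (exp a * sin b + - 0 + - b)
  with (exp a * (sin b - b) + (exp a - 1) * b) by ring.
assert (T1 := Rabs_triang (exp a - 1 - a) (- (exp a * (1 - cos b)))).
assert (T2 := Rabs_triang (exp a * (sin b - b)) ((exp a - 1) * b)).
rewrite Rabs_Ropp in T1; nra.
Qed.

(** An explicit quadratic remainder can be summed over the terms of a series, so termwise
    differentiation needs no theorem on uniform limits. *)
Lemma is_derive_C_quadratic (f : C -> C) (z l : C) (M : R) : 0 < M ->
  (forall h, Cmod h <= 1 ->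
     Cmod (f (z + h) - f z - h * l)%C <= M * Cmod h ^ 2) ->
  is_derive (K := C_AbsRing) (V := C_NormedModule) f z l.
Proof.
intros HM H; split; [apply is_linear_scal_l|].
intros x Hx.
rewrite <- (@is_filter_lim_locally_unique C_AbsRing
              (AbsRing_NormedModule C_AbsRing) z x Hx).
intros eps; unfold norm; simpl.
assert (Hd : 0 < Rmin 1 (eps / M)).
{ apply Rmin_pos; [lra|]; apply Rdiv_lt_0_compat; [apply cond_pos|exact HM]. }
exists (mkposreal _ Hd); intros y Hy; unfold ball in Hy; simpl in Hy.
unfold AbsRing_ball, abs in Hy; simpl in Hy.
change (Cmod (f y - f z - (y - z) * l)%C <= eps * Cmod (y - z)%C).
change (Cmod (y - z)%C < Rmin 1 (eps / M)) in Hy.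
set (h := (y - z)%C) in *.
replace y with (z + h)%C by (unfold h; ring).
assert (H1 := Rmin_l 1 (eps / M)); assert (H2 := Rmin_r 1 (eps / M)).
assert (H0 := Cmod_ge_0 h).
eapply Rle_trans; [apply H; lra|].
replace (M * Cmod h ^ 2) with ((M * Cmod h) * Cmod h) by ring.
apply Rmult_le_compat_r; [exact H0|].
apply Rle_trans with (M * (eps / M)); [apply Rmult_le_compat_l; lra|].
apply Req_le; field; lra.
Qed.

Lemma ex_series_Rmult (c : R) (a : nat -> R) :
  ex_series a -> ex_series (fun n => c * a n).
Proof. exact (ex_series_scal (V := R_NormedModule) c a). Qed.

Definition CSeries (c : nat -> C) : C :=
  (Series (fun j => Re (c j)), Series (fun j => Im (c j))).

Lemma ex_series_Re_Im (c : nat -> C) : ex_series (fun j => Cmod (c j)) ->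
  ex_series (fun j => Re (c j)) /\ ex_series (fun j => Im (c j)).
Proof.
intros H; split.
  apply (ex_series_le (V := R_CompleteNormedModule)) with (2 := H).
  intros j; apply re_le_Cmod.
apply (ex_series_le (V := R_CompleteNormedModule)) with (2 := H).
intros j; apply abs_Im_le_Cmod.
Qed.

(** This one form serves both for plain differences, with h = 1, and for removing the linear term of
    an expansion in h. *)
Lemma CSeries_lin (c d : nat -> C) (h : C) :
  ex_series (fun j => Cmod (c j)) -> ex_series (fun j => Cmod (d j)) ->
  CSeries (fun j => c j - h * d j)%C = (CSeries c - h * CSeries d)%C.
Proof.
intros Hc Hd.
destruct (ex_series_Re_Im c Hc) as [C1 C2].
destruct (ex_series_Re_Im d Hd) as [D1 D2].
destruct h as [x y]; unfold CSeries, Cminus, Cplus, Copp, Cmult; simpl.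
f_equal.
  rewrite (Series_ext _ (fun j => Re (c j) - (x * Re (d j) - y * Im (d j))))
    by (intros; unfold Re, Im; ring).
  rewrite Series_minus, Series_minus, !Series_scal_l;
    [reflexivity|apply (ex_series_Rmult x), D1|apply (ex_series_Rmult y), D2
    |exact C1|].
  apply (ex_series_minus (V := R_NormedModule));
    [apply (ex_series_Rmult x), D1|apply (ex_series_Rmult y), D2].
rewrite (Series_ext _ (fun j => Im (c j) - (x * Im (d j) + y * Re (d j))))
  by (intros; unfold Re, Im; ring).
rewrite Series_minus, Series_plus, !Series_scal_l;
  [reflexivity|apply (ex_series_Rmult x), D2|apply (ex_series_Rmult y), D1
  |exact C2|].
apply (ex_series_plus (V := R_NormedModule));
  [apply (ex_series_Rmult x), D2|apply (ex_series_Rmult y), D1].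
Qed.

Lemma Cmod_CSeries (c : nat -> C) (M : nat -> R) :
  (forall j, Cmod (c j) <= M j) -> ex_series M ->
  Cmod (CSeries c) <= 2 * Series M.
Proof.
intros H HM; eapply Rle_trans; [apply Cmod_le_abs|]; simpl.
assert (B : forall u : nat -> R, (forall j, Rabs (u j) <= M j) ->
  Rabs (Series u) <= Series M).
{ intros u Hu; eapply Rle_trans; [apply Series_Rabs|].
    apply (ex_series_le (V := R_CompleteNormedModule)) with (2 := HM).
    intros j; unfold norm; simpl; unfold abs; simpl; rewrite Rabs_Rabsolu; apply Hu.
  apply Series_le; [|exact HM].
  intros j; split; [apply Rabs_pos|apply Hu]. }
assert (B1 := B (fun j => Re (c j)) (fun j => Rle_trans _ _ _ (re_le_Cmod _) (H j))).
assert (B2 := B (fun j => Im (c j)) (fun j => Rle_trans _ _ _ (abs_Im_le_Cmod _) (H j))).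
lra.
Qed.

Definition dterm (a l : nat -> R) (z : C) (j : nat) : C :=
  (RtoC (a j) * Cexp (z * RtoC (l j)))%C.

Lemma Cmod_dterm (a l : nat -> R) (z : C) (k j : nat) : Rabs (Re z) <= INR k ->
  Cmod (dterm a l z j) <= Rabs (a j) * exp (INR k * Rabs (l j)).
Proof.
intros Hk; unfold dterm; rewrite Cmod_mult, Cmod_R, Cmod_Cexp.
apply Rmult_le_compat_l; [apply Rabs_pos|apply exp_le].
replace (Re (z * l j)%C) with (Re z * l j)
  by (destruct z; unfold Cmult, RtoC; simpl; ring).
eapply Rle_trans; [apply Rle_abs|]; rewrite Rabs_mult.
apply Rmult_le_compat_r; [apply Rabs_pos|exact Hk].
Qed.

Lemma exists_nat_ge (x : R) : exists k : nat, x <= INR k.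
Proof.
destruct (Rle_dec x 0) as [H|H]; [exists 0%nat; exact H|].
destruct (nfloor_ex x) as [n [_ Hn]]; [lra|].
exists (S n); rewrite S_INR; lra.
Qed.

(** Absolute convergence of sum a_j e^(z l_j) with a common majorant on each strip |Re z| <= k. *)
Definition exp_summable (a l : nat -> R) : Prop :=
  forall k : nat, ex_series (fun j => Rabs (a j) * exp (INR k * Rabs (l j))).

Lemma ex_series_dterm (a l : nat -> R) (z : C) : exp_summable a l ->
  ex_series (fun j => Cmod (dterm a l z j)).
Proof.
intros H; destruct (exists_nat_ge (Rabs (Re z))) as [k Hk].
apply (ex_series_le (V := R_CompleteNormedModule)) with (2 := H k).
intros j; unfold norm; simpl; unfold abs; simpl.
rewrite Rabs_pos_eq by apply Cmod_ge_0; apply Cmod_dterm, Hk.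
Qed.

Lemma id_le_exp (x : R) : x <= exp x.
Proof. assert (H := exp_ineq1_le x); lra. Qed.

(** The extra factor is absorbed by |l| <= e^|l|, at the price of passing from k to k + 1. *)
Lemma exp_summable_mult (a l : nat -> R) : exp_summable a l ->
  exp_summable (fun j => a j * l j) l.
Proof.
intros H k.
apply (ex_series_le (V := R_CompleteNormedModule)) with (2 := H (S k)).
intros j; unfold norm; simpl norm; unfold abs; simpl abs.
rewrite Rabs_pos_eq
  by (apply Rmult_le_pos; [apply Rabs_pos|apply Rlt_le, exp_pos]).
rewrite Rabs_mult, S_INR, Rmult_plus_distr_r, Rmult_1_l, exp_plus, Rmult_assoc.
apply Rmult_le_compat_l; [apply Rabs_pos|].
rewrite Rmult_comm; apply Rmult_le_compat_l; [apply Rlt_le, exp_pos|].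
apply id_le_exp.
Qed.

(** The shift by 3: |h l|^2 costs two factors e^|l|, and e^|h l| with |h| <= 1 costs one. *)
Lemma dterm_second_order (a l : nat -> R) (z h : C) (k j : nat) :
  Rabs (Re z) <= INR k -> Cmod h <= 1 ->
  Cmod (dterm a l (z + h) j - dterm a l z j
        - h * dterm (fun j => a j * l j)%R l z j)%C
  <= 4 * Cmod h ^ 2 * (Rabs (a j) * exp (INR (k + 3) * Rabs (l j))).
Proof.
intros Hk Hh.
replace (dterm a l (z + h) j - dterm a l z j
        - h * dterm (fun j => a j * l j)%R l z j)%C
  with (dterm a l z j * (Cexp (h * l j) - 1 - h * l j))%C.
2:{ unfold dterm; rewrite Cmult_plus_distr_r, Cexp_plus, RtoC_mult; ring. }
rewrite Cmod_mult.
eapply Rle_trans.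
  apply Rmult_le_compat; [apply Cmod_ge_0|apply Cmod_ge_0|
    apply Cmod_dterm, Hk|apply Cexp_second_order].
rewrite Cmod_mult, Cmod_R.
set (L := Rabs (l j)); assert (HL : 0 <= L) by apply Rabs_pos.
assert (H0 := Cmod_ge_0 h).
replace (INR (k + 3) * L) with (INR k * L + (L + L + L))
  by (rewrite plus_INR; simpl; ring).
rewrite !exp_plus.
replace (4 * Cmod h ^ 2 * (Rabs (a j) * (exp (INR k * L) * (exp L * exp L * exp L))))
  with (Rabs (a j) * exp (INR k * L) * (4 * (Cmod h ^ 2) * (exp L * exp L) * exp L))
  by ring.
apply Rmult_le_compat_l.
  apply Rmult_le_pos; [apply Rabs_pos|apply Rlt_le, exp_pos].
assert (E := id_le_exp L).
apply Rmult_le_compat; [|apply Rlt_le, exp_pos| |apply exp_le; nra].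
  assert (H2 := pow2_ge_0 (Cmod h * L)); lra.
rewrite Rpow_mult_distr, <- Rmult_assoc.
apply Rmult_le_compat_l; [assert (H2 := pow2_ge_0 (Cmod h)); lra|nra].
Qed.

Lemma entire_CSeries (a l : nat -> R) : exp_summable a l ->
  entire (fun s => CSeries (dterm a l (s - 1)%C)).
Proof.
intros H z.
exists (CSeries (dterm (fun j => a j * l j) l (z - 1)%C)).
destruct (exists_nat_ge (Rabs (Re (z - 1)%C))) as [k Hk].
set (M := Series (fun j => Rabs (a j) * exp (INR (k + 3) * Rabs (l j)))).
assert (HM : 0 <= M).
{ unfold M.
  apply Rle_trans with (Series (fun _ => 0 * 0)).
    rewrite Series_scal_l; lra.
  apply Series_le; [|apply H].
  intros j; split; [lra|]; rewrite Rmult_0_l.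
  apply Rmult_le_pos; [apply Rabs_pos|apply Rlt_le, exp_pos]. }
(* 8 is the 4 of [dterm_second_order] times the 2 of [Cmod_CSeries]; adding 1 keeps the constant
   positive. *)
apply is_derive_C_quadratic with (8 * M + 1); [lra|].
intros h Hh.
replace (z + h - 1)%C with (z - 1 + h)%C by ring.
set (u := (z - 1)%C) in *.
assert (S1 := ex_series_dterm a l (u + h) H).
assert (S2 := ex_series_dterm a l u H).
assert (S3 := ex_series_dterm _ l u (exp_summable_mult a l H)).
assert (S4 : ex_series (fun j => Cmod (dterm a l (u + h) j - 1 * dterm a l u j)%C)).
{ apply (ex_series_le (V := R_CompleteNormedModule)) with
    (2 := ex_series_plus (V := R_NormedModule) _ _ S1 S2).
  intros j; unfold norm; simpl norm; unfold abs; simpl abs.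
  rewrite Rabs_pos_eq by apply Cmod_ge_0.
  unfold Cminus; eapply Rle_trans; [apply Cmod_triangle|].
  rewrite Cmod_opp, Cmult_1_l; apply Rle_refl. }
replace (CSeries (dterm a l (u + h)) - CSeries (dterm a l u))%C
  with (CSeries (fun j => dterm a l (u + h) j - 1 * dterm a l u j)%C)
  by (rewrite CSeries_lin by assumption; ring).
rewrite <- CSeries_lin by assumption.
eapply Rle_trans.
  apply Cmod_CSeries with
    (M := fun j => 4 * Cmod h ^ 2 * (Rabs (a j) * exp (INR (k + 3) * Rabs (l j)))).
    intros j; rewrite Cmult_1_l; apply dterm_second_order; assumption.
  apply (ex_series_Rmult (4 * Cmod h ^ 2)), H.
rewrite Series_scal_l; fold M.
assert (H2 := pow2_ge_0 (Cmod h)); nra.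
Qed.

(** * Improper integrals over the positive half-line *)

Notation is_int f l := (is_RInt_gen f (at_right 0) (Rbar_locally p_infty) l).

Lemma prod_ends (P Q : R -> Prop) :
  at_right 0 P -> Rbar_locally p_infty Q ->
  filter_prod (at_right 0) (Rbar_locally p_infty)
    (fun ab => 0 < fst ab <= snd ab /\ P (fst ab) /\ Q (snd ab)).
Proof.
intros HP HQ.
apply Filter_prod with (fun a => (0 < a < 1) /\ P a) (fun b => 1 < b /\ Q b).
- apply filter_and; [|exact HP].
  exists (mkposreal _ Rlt_0_1); intros y Hy H0; split; [exact H0|].
  unfold ball in Hy; simpl in Hy; unfold AbsRing_ball, abs, minus, plus, opp in Hy;
  simpl in Hy; apply Rabs_def2 in Hy; lra.
- apply filter_and; [exists 1; auto|exact HQ].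
- intros a b [Ha Pa] [Hb Qb]; simpl; repeat split; auto; lra.
Qed.

Lemma prod_pos : filter_prod (at_right 0) (Rbar_locally p_infty)
  (fun ab : R * R => 0 < fst ab <= snd ab).
Proof.
apply filter_imp with (2 := prod_ends (fun _ => True) (fun _ => True)
  filter_true filter_true); tauto.
Qed.

Lemma is_int_ext {V : NormedModule R_AbsRing} (f g : R -> V) (l : V) :
  (forall t, 0 < t -> f t = g t) -> is_int f l -> is_int g l.
Proof.
intros H; apply is_RInt_gen_ext.
apply filter_imp with (2 := prod_pos); intros [a b] Hab x; simpl in *.
rewrite Rmin_left by lra; intros Hx; apply H; lra.
Qed.

Lemma is_int_primitive (F f : R -> R) (l0 l1 : R) :
  (forall t, 0 < t -> is_derive F t (f t)) ->
  (forall t, 0 < t -> continuous f t) ->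
  filterlim F (at_right 0) (locally l0) ->
  filterlim F (Rbar_locally p_infty) (locally l1) ->
  is_int f (l1 - l0).
Proof.
intros HD HC H0 H1.
apply (filterlimi_lim_ext_loc (fun ab => F (snd ab) - F (fst ab))).
  apply filter_imp with (2 := prod_pos); intros [a b] Hab; simpl in *.
  apply (is_RInt_derive (V := R_CompleteNormedModule) F f); intros x;
    rewrite Rmin_left by lra; intros Hx; [apply HD|apply HC]; lra.
apply (filterlim_comp_2 (G := locally l1) (H := locally (- l0))
  (fun ab => F (snd ab)) (fun ab => - F (fst ab)) Rplus).
- apply filterlim_comp with (2 := H1); apply filterlim_snd.
- apply (filterlim_comp _ _ _ (fun ab => F (fst ab)) Ropp _ (locally l0)).
    apply filterlim_comp with (2 := H0); apply filterlim_fst.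
  apply (filterlim_opp (V := R_NormedModule)).
- apply (filterlim_plus (V := R_NormedModule)).
Qed.

Lemma plus_minus_mid {G : AbelianGroup} (x y z : G) :
  plus x z = minus (plus x (plus y z)) y.
Proof.
unfold minus; rewrite (plus_comm y z), !plus_assoc, <- (plus_assoc (plus x z)).
rewrite plus_opp_r, plus_zero_r; reflexivity.
Qed.

Section Domination.

Context {V : CompleteNormedModule R_AbsRing}.
Variables (f : R -> V) (F phi : R -> R) (l0 l1 : R).
Hypothesis f_cont : forall t, 0 < t -> continuous f t.
Hypothesis f_le : forall t, 0 < t -> norm (f t) <= phi t.
Hypothesis F_derive : forall t, 0 < t -> is_derive F t (phi t).
Hypothesis phi_cont : forall t, 0 < t -> continuous phi t.
Hypothesis F_0 : filterlim F (at_right 0) (locally l0).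
Hypothesis F_oo : filterlim F (Rbar_locally p_infty) (locally l1).

Lemma ex_RInt_pos (a b : R) : 0 < a -> 0 < b -> ex_RInt f a b.
Proof.
intros Ha Hb; apply ex_RInt_continuous; intros z Hz; apply f_cont.
apply Rlt_le_trans with (2 := proj1 Hz); apply Rmin_pos; assumption.
Qed.

Lemma norm_RInt_primitive (a b : R) : 0 < a -> 0 < b ->
  norm (RInt f a b) <= Rabs (F b - F a).
Proof.
assert (H : forall a b, 0 < a <= b -> norm (RInt f a b) <= Rabs (F b - F a)).
{ intros u v Huv; eapply Rle_trans; [|apply Rle_abs].
  apply (norm_RInt_le f phi u v); [lra| | |].
  - intros x Hx; apply f_le; lra.
  - apply RInt_correct, ex_RInt_pos; lra.
  - apply (is_RInt_derive (V := R_CompleteNormedModule) F phi); intros x;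
      rewrite Rmin_left by lra; intros Hx; [apply F_derive|apply phi_cont]; lra. }
intros Ha Hb; destruct (Rle_dec a b); [apply H; lra|].
rewrite <- opp_RInt_swap by (apply ex_RInt_pos; assumption).
eapply Rle_trans; [apply Req_le, (norm_opp (RInt f b a))|].
rewrite Rabs_minus_sym; apply H; lra.
Qed.

(** Cauchy criterion: two integrals over [a, b] and [a', b'] differ by two end pieces, bounded by
    the increments of F there. With F within eps/4 of its limits, each increment is below eps/2. *)
Lemma ex_int_dominated : exists l, is_int f l.
Proof.
apply (filterlimi_locally_cauchy (F := filter_prod (at_right 0) (Rbar_locally p_infty))
  (fun ab : R * R => is_RInt f (fst ab) (snd ab))).
{ apply filter_imp with (2 := prod_pos); intros [a b] Hab; simpl in *; split.
    apply ex_RInt_pos; lra.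
  intros y1 y2 H1 H2.
  rewrite <- (is_RInt_unique _ _ _ _ H1); apply is_RInt_unique, H2. }
intros eps.
assert (He : 0 < eps / 4) by (assert (H := cond_pos eps); lra).
set (e := mkposreal _ He).
exists (fun ab => 0 < fst ab <= snd ab /\ ball l0 e (F (fst ab))
                  /\ ball l1 e (F (snd ab))).
split.
  apply (prod_ends (fun a => ball l0 e (F a)) (fun b => ball l1 e (F b))).
    apply F_0; exists e; auto.
  apply F_oo; exists e; auto.
intros [a b] [a' b']; simpl; intros [Hab [A B]] [Hab' [A' B']] u u' Hu Hu'.
apply (norm_compat1 (K := R_AbsRing) (V := V)).
rewrite <- (is_RInt_unique _ _ _ _ Hu), <- (is_RInt_unique _ _ _ _ Hu').
assert (E : plus (RInt f a' a) (RInt f b b')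
            = minus (RInt f a' b') (RInt f a b)).
{ rewrite <- (RInt_Chasles f a' a b') by (apply ex_RInt_pos; lra).
  rewrite <- (RInt_Chasles f a b b') by (apply ex_RInt_pos; lra).
  exact (plus_minus_mid (G := CompleteNormedModule.AbelianGroup R_AbsRing V)
    (RInt f a' a) (RInt f a b) (RInt f b b')). }
refine (Rle_lt_trans _ _ _ (Req_le _ _ (f_equal norm (eq_sym E))) _).
eapply Rle_lt_trans; [apply (norm_triangle (V := V))|].
assert (N1 := norm_RInt_primitive a' a ltac:(lra) ltac:(lra)).
assert (N2 := norm_RInt_primitive b b' ltac:(lra) ltac:(lra)).
unfold ball in A, B, A', B'; simpl in A, B, A', B'.
unfold AbsRing_ball, abs, minus, plus, opp in A, B, A', B'; simpl in A, B, A', B'.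
apply Rabs_def2 in A; apply Rabs_def2 in B; apply Rabs_def2 in A';
apply Rabs_def2 in B'.
assert (Rabs (F a - F a') < eps / 2) by (apply Rabs_def1; lra).
assert (Rabs (F b' - F b) < eps / 2) by (apply Rabs_def1; lra).
apply Rle_lt_trans with (1 := Rplus_le_compat _ _ _ _ N1 N2); lra.
Qed.

Lemma norm_int_dominated (l : V) : is_int f l -> norm l <= l1 - l0.
Proof.
intros H; apply (RInt_gen_norm (Fa := at_right 0) (Fb := Rbar_locally p_infty) f phi).
- apply filter_imp with (2 := prod_pos); intros; lra.
- apply filter_imp with (2 := prod_pos); intros [a b] Hab x Hx; simpl in *.
  apply f_le; lra.
- exact H.
- apply (is_int_primitive F); assumption.
Qed.

End Domination.

(** The norm inequality for integrals, applied to the zero function dominated by g. *)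
Lemma is_int_ge_0 (g : R -> R) (l : R) :
  (forall t, 0 < t -> 0 <= g t) -> is_int g l -> 0 <= l.
Proof.
intros H Hg.
assert (H0 : is_int (fun _ : R => 0) 0).
{ rewrite <- (Rminus_diag 0) at 2; apply (is_int_primitive (fun _ => 0)).
  - intros; auto_derive; trivial.
  - intros; apply continuous_const.
  - apply filterlim_const.
  - apply filterlim_const. }
rewrite <- Rabs_R0; change (norm (0 : R_NormedModule) <= l).
apply (RInt_gen_norm (V := R_CompleteNormedModule)
  (Fa := at_right 0) (Fb := Rbar_locally p_infty) (fun _ => 0) g).
- apply filter_imp with (2 := prod_pos); intros; lra.
- apply filter_imp with (2 := prod_pos); intros [a b] Hab x Hx; simpl in *.
  change (Rabs 0 <= g x); rewrite Rabs_R0; apply H; lra.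
- exact H0.
- exact Hg.
Qed.

(** * Complex-valued improper integrals and substitution *)

Section Components.

Context {Fa Fb : (R -> Prop) -> Prop} {FFa : Filter Fa} {FFb : Filter Fb}.

Lemma is_RInt_gen_fst (f : R -> C) (l : C) :
  is_RInt_gen (V := C_R_NormedModule) f Fa Fb l ->
  is_RInt_gen (fun t => fst (f t)) Fa Fb (fst l).
Proof.
intros H; apply filterlimi_locally; intros eps.
generalize (proj1 (filterlimi_locally _ _) H eps); apply filter_imp.
intros [a b] [z [Hz Bz]]; exists (fst z); split; [|apply Bz].
apply is_RInt_fct_extend_fst in Hz; exact Hz.
Qed.

Lemma is_RInt_gen_snd (f : R -> C) (l : C) :
  is_RInt_gen (V := C_R_NormedModule) f Fa Fb l ->
  is_RInt_gen (fun t => snd (f t)) Fa Fb (snd l).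
Proof.
intros H; apply filterlimi_locally; intros eps.
generalize (proj1 (filterlimi_locally _ _) H eps); apply filter_imp.
intros [a b] [z [Hz Bz]]; exists (snd z); split; [|apply Bz].
apply is_RInt_fct_extend_snd in Hz; exact Hz.
Qed.

Lemma is_RInt_gen_pair (f : R -> C) (l : C) :
  is_RInt_gen (fun t => fst (f t)) Fa Fb (fst l) ->
  is_RInt_gen (fun t => snd (f t)) Fa Fb (snd l) ->
  is_RInt_gen (V := C_R_NormedModule) f Fa Fb l.
Proof.
intros H1 H2; apply filterlimi_locally; intros eps.
generalize (filter_and _ _ (proj1 (filterlimi_locally _ _) H1 eps)
  (proj1 (filterlimi_locally _ _) H2 eps)); apply filter_imp.
intros [a b] [[u [Hu Bu]] [v [Hv Bv]]]; exists (u, v); split; [|split; assumption].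
apply (is_RInt_fct_extend_pair (U := R_NormedModule) (V := R_NormedModule));
  assumption.
Qed.

Lemma is_RInt_gen_Cmult (f : R -> C) (c l : C) :
  is_RInt_gen (V := C_R_NormedModule) f Fa Fb l ->
  is_RInt_gen (V := C_R_NormedModule) (fun t => c * f t)%C Fa Fb (c * l)%C.
Proof.
intros H; assert (H1 := is_RInt_gen_fst f l H); assert (H2 := is_RInt_gen_snd f l H).
apply is_RInt_gen_pair; simpl.
- apply (is_RInt_gen_minus (V := R_NormedModule));
    apply (is_RInt_gen_scal (V := R_NormedModule)); assumption.
- apply (is_RInt_gen_plus (V := R_NormedModule));
    apply (is_RInt_gen_scal (V := R_NormedModule)); assumption.
Qed.

End Components.

(** The endpoints are pushed forward along g and the proper substitution rule is applied on each
    interval. As [Ga] and [Gb] are arbitrary, decreasing substitutions are covered. *)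
Lemma is_RInt_gen_comp {V : CompleteNormedModule R_AbsRing}
  {Fa Fb Ga Gb : (R -> Prop) -> Prop} {FFa : Filter Fa} {FFb : Filter Fb}
  (f : R -> V) (g dg : R -> R) (l : V) :
  filterlim g Fa Ga -> filterlim g Fb Gb ->
  filter_prod Fa Fb (fun ab => forall x,
     Rmin (fst ab) (snd ab) <= x <= Rmax (fst ab) (snd ab) ->
     continuous f (g x) /\ is_derive g x (dg x) /\ continuous dg x) ->
  is_RInt_gen f Ga Gb l ->
  is_RInt_gen (fun x => scal (dg x) (f (g x))) Fa Fb l.
Proof.
intros Ha Hb Hg Hf P HP.
destruct (Hf P HP) as [Q1 Q2 HQ1 HQ2 HQ].
assert (H1 : filter_prod Fa Fb (fun ab => Q1 (g (fst ab)) /\ Q2 (g (snd ab)))).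
{ apply Filter_prod with (fun a => Q1 (g a)) (fun b => Q2 (g b)).
  - apply Ha, HQ1.
  - apply Hb, HQ2.
  - intros a b A B; split; assumption. }
refine (filter_imp _ _ _ (filter_and _ _ Hg H1)).
intros [a b] [H2 [A B]]; simpl in *.
destruct (HQ _ _ A B) as [v [Hv Pv]]; exists v; split; [|exact Pv].
simpl in Hv; rewrite <- (is_RInt_unique _ _ _ _ Hv).
apply is_RInt_comp; intros x Hx; apply (H2 x Hx).
Qed.

(** * The Gamma integral *)

(** Its derivative [dom] dominates [e^(-a t) t^(x-1)] up to a constant. *)
Definition dom_prim (x t : R) : R := exp (x * ln (t / (1 + t))).
Definition dom (x t : R) : R := x * dom_prim x t / (t * (1 + t)).

Lemma is_derive_dom_prim (x t : R) : 0 < t -> is_derive (dom_prim x) t (dom x t).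
Proof.
intros Ht; unfold dom, dom_prim.
auto_derive.
  assert (0 < t * / (1 + t)) by (apply Rdiv_lt_0_compat; lra).
  repeat split; lra.
unfold Rdiv; field; lra.
Qed.

Lemma continuous_dom (x t : R) : 0 < t -> continuous (dom x) t.
Proof.
intros Ht; apply (ex_derive_continuous (V := R_NormedModule)).
unfold dom, dom_prim; auto_derive.
assert (0 < t * / (1 + t)) by (apply Rdiv_lt_0_compat; lra).
repeat split; try lra.
apply Rgt_not_eq, Rmult_lt_0_compat; lra.
Qed.

(** These inequalities squeeze [dom_prim] to 0 at 0, by t^x, and to 1 at infinity, by 1 - x/t. *)
Lemma dom_prim_bounds (x t : R) : 0 < x -> 0 < t ->
  1 - x / t <= dom_prim x t <= 1 /\ dom_prim x t <= exp (x * ln t).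
Proof.
intros Hx Ht; unfold dom_prim.
assert (H1 : ln (t / (1 + t)) <= 0).
{ rewrite <- ln_1; apply ln_le; [apply Rdiv_lt_0_compat; lra|].
  apply Rmult_le_reg_r with (1 + t); [lra|].
  unfold Rdiv; rewrite Rmult_assoc, Rinv_l; lra. }
assert (H2 : - / t <= ln (t / (1 + t))).
{ apply Ropp_le_cancel; rewrite Ropp_involutive.
  replace (t / (1 + t)) with (/ (1 + / t)) by (field; lra).
  assert (H := Rinv_0_lt_compat t Ht).
  rewrite ln_Rinv, Ropp_involutive by lra.
  rewrite <- (ln_exp (/ t)) at 2; apply ln_le; [lra|apply exp_ineq1_le]. }
repeat split.
- eapply Rle_trans; [|apply exp_ineq1_le].
  assert (H := Rmult_le_compat_l x _ _ (Rlt_le _ _ Hx) H2); unfold Rdiv in *; lra.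
- apply Rle_trans with (exp (x * 0)); [apply exp_le, Rmult_le_compat_l; lra|].
  rewrite Rmult_0_r, exp_0; apply Rle_refl.
- apply exp_le, Rmult_le_compat_l; [lra|].
  apply ln_le; [apply Rdiv_lt_0_compat; lra|].
  apply Rmult_le_reg_r with (1 + t); [lra|].
  unfold Rdiv; rewrite Rmult_assoc, Rinv_l by lra; nra.
Qed.

Lemma at_right_0_intro (d : R) (P : R -> Prop) : 0 < d ->
  (forall t, 0 < t < d -> P t) -> at_right 0 P.
Proof.
intros Hd H; exists (mkposreal d Hd); intros y Hy H0; apply H; split; [exact H0|].
unfold ball in Hy; simpl in Hy; unfold AbsRing_ball, abs, minus, plus, opp in Hy;
simpl in Hy; apply Rabs_def2 in Hy; lra.
Qed.

Lemma ball_R_intro (x y eps : R) : Rabs (y - x) < eps -> ball x eps y.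
Proof. intros H; exact H. Qed.

Lemma dom_prim_0 (x : R) : 0 < x ->
  filterlim (dom_prim x) (at_right 0) (locally 0).
Proof.
intros Hx; apply filterlim_locally; intros eps.
apply at_right_0_intro with (exp (ln eps / x)); [apply exp_pos|].
intros t [Ht H]; apply ball_R_intro.
assert (B := dom_prim_bounds x t Hx Ht).
assert (H0 : 0 < dom_prim x t) by apply exp_pos.
rewrite Rminus_0_r, Rabs_pos_eq by lra.
apply Rle_lt_trans with (1 := proj2 B).
apply Rlt_le_trans with (exp (ln eps)).
  apply exp_increasing.
  assert (E : ln t < ln eps / x).
  { rewrite <- (ln_exp (ln eps / x)); apply ln_increasing; assumption. }
  apply (Rmult_lt_compat_l x) in E; [|exact Hx].
  replace (x * (ln eps / x)) with (ln eps) in E by (field; lra); exact E.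
rewrite exp_ln by apply cond_pos; apply Rle_refl.
Qed.

Lemma dom_prim_oo (x : R) : 0 < x ->
  filterlim (dom_prim x) (Rbar_locally p_infty) (locally 1).
Proof.
intros Hx; apply filterlim_locally; intros eps.
assert (He := cond_pos eps).
assert (H0 : 0 < x / eps) by (apply Rdiv_lt_0_compat; lra).
exists (x / eps); intros t Ht; apply ball_R_intro.
assert (Ht0 : 0 < t) by lra; assert (B := dom_prim_bounds x t Hx Ht0).
assert (H1 : x / t < eps).
{ apply (Rmult_lt_compat_l eps) in Ht; [|lra].
  replace (eps * (x / eps)) with x in Ht by (field; lra).
  apply Rmult_lt_reg_r with t; [lra|].
  unfold Rdiv; rewrite Rmult_assoc, Rinv_l; lra. }
apply Rabs_def1; lra.
Qed.

Lemma exp_dominated (a x : R) : 0 < a -> 0 < x ->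
  exists K, 0 < K /\
    forall t, 0 < t -> exp (- (a * t) + (x - 1) * ln t) <= K * dom x t.
Proof.
intros Ha Hx.
(* Since dom = x t^(x-1) / (1+t)^(x+1), the claim is (x+1) ln(1+t) <= a t + c. This is the tangent
   line of ln at m, where (x+1) ln has slope a. *)
set (m := (x + 1) / a).
assert (Hm : 0 < m) by (apply Rdiv_lt_0_compat; lra).
set (c := a + (x + 1) * (ln m - 1)).
exists (exp c / x); split; [apply Rdiv_lt_0_compat; [apply exp_pos|exact Hx]|].
intros t Ht.
assert (H1 : ln (1 + t) <= (1 + t) / m + ln m - 1).
{ assert (H := exp_ineq1_le (ln ((1 + t) / m))).
  rewrite exp_ln in H by (apply Rdiv_lt_0_compat; lra).
  unfold Rdiv at 1 in H; rewrite ln_mult, ln_Rinv in H;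
    [lra|exact Hm|lra|apply Rinv_0_lt_compat, Hm]. }
apply (Rmult_le_compat_l (x + 1)) in H1; [|lra].
replace ((x + 1) * ((1 + t) / m + ln m - 1))
  with (a * t + c) in H1 by (unfold c, m; field; lra).
replace (exp c / x * dom x t)
  with (exp (c + x * ln (t / (1 + t)) - ln t - ln (1 + t))).
2:{ unfold dom, dom_prim, Rminus; rewrite !exp_plus, !exp_Ropp, !exp_ln by lra.
    field; lra. }
apply exp_le.
unfold Rdiv; rewrite ln_mult, ln_Rinv by (try apply Rinv_0_lt_compat; lra); lra.
Qed.

(** [e^(-a t) t^(z-1)]. *)
Definition gker (a : R) (z : C) (t : R) : C :=
  Cexp (- (a * t) + (Re z - 1) * ln t, Im z * ln t).

Lemma gker_Rcpow (a : R) (z : C) (t : R) :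
  gker a z t = (RtoC (exp (- (a * t))) * Rcpow t (z - 1))%C.
Proof.
unfold gker, Rcpow, Cexp; destruct z as [x y].
unfold Cmult, Cminus, Cplus, Copp, RtoC; simpl; rewrite exp_plus.
replace ((x + - (1)) * ln t - (y + - 0) * 0) with ((x - 1) * ln t) by ring.
replace ((x + - (1)) * 0 + (y + - 0) * ln t) with (y * ln t) by ring.
f_equal; ring.
Qed.

Lemma norm_C_R (z : C) : norm (V := C_R_NormedModule) z = Cmod z.
Proof.
unfold norm; simpl; unfold prod_norm, Cmod; f_equal.
change (Rabs (fst z) ^ 2 + Rabs (snd z) ^ 2 = fst z ^ 2 + snd z ^ 2).
rewrite !pow2_abs; reflexivity.
Qed.

Lemma continuous_C_pair (f g : R -> R) (t : R) :
  continuous f t -> continuous g t ->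
  continuous (U := C_R_NormedModule) (fun u => (f u, g u)) t.
Proof.
intros Hf Hg; apply filterlim_locally; intros eps.
refine (filter_imp _ _ _ (filter_and _ _ (proj1 (filterlim_locally _ _) Hf eps)
  (proj1 (filterlim_locally _ _) Hg eps))).
intros u H; exact H.
Qed.

Lemma continuous_gker (a : R) (z : C) (t : R) : 0 < t ->
  continuous (U := C_R_NormedModule) (gker a z) t.
Proof.
intros Ht; apply continuous_C_pair;
  apply (ex_derive_continuous (V := R_NormedModule)); simpl; auto_derive; auto.
Qed.

Lemma ex_int_gker (a : R) (z : C) : 0 < a -> 0 < Re z ->
  exists l, is_RInt_gen (V := C_R_NormedModule) (gker a z)
              (at_right 0) (Rbar_locally p_infty) l.
Proof.
intros Ha Hz; destruct (exp_dominated a (Re z) Ha Hz) as [K [HK H]].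
apply (ex_int_dominated (V := C_R_CompleteNormedModule) (gker a z)
  (fun t => K * dom_prim (Re z) t) (fun t => K * dom (Re z) t) (K * 0) (K * 1)).
- intros t Ht; apply continuous_gker, Ht.
- intros t Ht; change (norm (V := C_R_NormedModule) (gker a z t) <= K * dom (Re z) t).
  rewrite norm_C_R; unfold gker; rewrite Cmod_Cexp; apply H, Ht.
- intros t Ht; apply is_derive_scal, is_derive_dom_prim, Ht.
- intros t Ht; apply (continuous_scal_r (V := R_NormedModule) K), continuous_dom, Ht.
- apply filterlim_comp with (1 := dom_prim_0 _ Hz).
  apply (filterlim_scal_r (V := R_NormedModule)).
- apply filterlim_comp with (1 := dom_prim_oo _ Hz).
  apply (filterlim_scal_r (V := R_NormedModule)).
Qed.

Lemma is_int_CGamma (z : C) : 0 < Re z ->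
  is_RInt_gen (V := C_R_NormedModule) (gker 1 z)
    (at_right 0) (Rbar_locally p_infty) (CGamma z).
Proof.
intros Hz; destruct (ex_int_gker 1 z Rlt_0_1 Hz) as [l Hl].
assert (E : CGamma z = l); [|rewrite E; exact Hl].
unfold CGamma.
apply (is_RInt_gen_unique (V := C_R_CompleteNormedModule)
  (Fa := at_right 0) (Fb := Rbar_locally p_infty)
  (fun t => RtoC (exp (- t)) * Rcpow t (z - 1))%C l).
apply (is_int_ext (V := C_R_NormedModule) (gker 1 z)); [|exact Hl].
intros t _; rewrite gker_Rcpow, Rmult_1_l; reflexivity.
Qed.

(** Substitution of a t for t. With a = (j+1)/2 and z = s - 1 it integrates the j-th term of the
    series. *)
Lemma is_int_gker (a : R) (z : C) : 0 < a -> 0 < Re z ->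
  is_RInt_gen (V := C_R_NormedModule) (gker a z)
    (at_right 0) (Rbar_locally p_infty) (Rcpow (/ a) z * CGamma z)%C.
Proof.
intros Ha Hz.
apply (is_int_ext (V := C_R_NormedModule)
  (fun t => Rcpow (/ a) z * scal a (gker 1 z (a * t)) : C)%C).
{ intros t Ht; unfold gker, Rcpow; rewrite scal_R_Cmult.
  replace (RtoC a) with (Cexp (RtoC (ln a)))
    by (unfold Cexp, RtoC; simpl; rewrite exp_ln, cos_0, sin_0 by exact Ha;
        f_equal; ring).
  rewrite <- !Cexp_plus; f_equal.
  rewrite ln_mult, ln_Rinv by assumption.
  destruct z as [x y]; unfold Cmult, Cplus, RtoC; simpl; f_equal; ring. }
apply is_RInt_gen_Cmult.
apply (is_RInt_gen_comp (V := C_R_CompleteNormedModule)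
  (Ga := at_right 0) (Gb := Rbar_locally p_infty)
  (gker 1 z) (fun t => a * t) (fun _ => a)).
- intros P [d Hd]; apply at_right_0_intro with (d / a).
    apply Rdiv_lt_0_compat; [apply cond_pos|exact Ha].
  intros t [Ht0 Ht]; apply Hd; [|apply Rmult_lt_0_compat; assumption].
  apply ball_R_intro; rewrite Rminus_0_r, Rabs_pos_eq by nra.
  apply (Rmult_lt_compat_l a) in Ht; [|exact Ha].
  replace (a * (d / a)) with (pos d) in Ht by (field; lra); exact Ht.
- intros P [M HM]; exists (M / a); intros t Ht; apply HM.
  apply (Rmult_lt_compat_l a) in Ht; [|exact Ha].
  replace (a * (M / a)) with M in Ht by (field; lra); exact Ht.
- apply filter_imp with (2 := prod_pos); intros [u v] Huv x; simpl in *.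
  rewrite Rmin_left by lra; intros Hx; split; [|split].
  + apply continuous_gker, Rmult_lt_0_compat; lra.
  + evar_last; [|apply Rmult_1_r].
    apply (is_derive_scal (fun t => t)), (is_derive_id (K := R_AbsRing)).
  + apply continuous_const.
- apply is_int_CGamma, Hz.
Qed.

Lemma exp_plus_ln (a t : R) : 0 < t -> exp (a + ln t) = exp a * t.
Proof. intros Ht; rewrite exp_plus, exp_ln by exact Ht; reflexivity. Qed.

(** e^-t t^x is at most t K dom = K x dom_prim / (1 + t): the numerator vanishes at 0, and the
    denominator forces decay at infinity. It disposes of boundary terms. *)
Lemma dominated_lim_0 (x : R) (g : R -> R) : 0 < x ->
  (forall t, 0 < t -> Rabs (g t) <= exp (- t + x * ln t)) ->
  filterlim g (at_right 0) (locally 0)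
  /\ filterlim g (Rbar_locally p_infty) (locally 0).
Proof.
intros Hx Hg; destruct (exp_dominated 1 x Rlt_0_1 Hx) as [K [HK H]].
assert (B : forall t, 0 < t -> Rabs (g t) * (1 + t) <= K * x * dom_prim x t).
{ intros t Ht.
  replace (K * x * dom_prim x t) with (t * (K * dom x t) * (1 + t))
    by (unfold dom; field; lra).
  apply Rmult_le_compat_r; [lra|].
  apply Rle_trans with (1 := Hg t Ht).
  apply Rle_trans with (t * exp (- (1 * t) + (x - 1) * ln t)).
    rewrite (Rmult_comm t (exp _)), <- exp_plus_ln by exact Ht.
    apply Req_le; f_equal; ring.
  apply Rmult_le_compat_l; [lra|apply H, Ht]. }
assert (HKx : 0 < K * x) by (apply Rmult_lt_0_compat; assumption).
split; apply filterlim_locally; intros eps; assert (He := cond_pos eps).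
- assert (He' : 0 < eps / (K * x)) by (apply Rdiv_lt_0_compat; assumption).
  destruct (proj1 (filterlim_locally _ _) (dom_prim_0 x Hx) (mkposreal _ He'))
    as [d Hd].
  apply at_right_0_intro with d; [apply cond_pos|]; intros t [Ht Htd].
  apply ball_R_intro; rewrite Rminus_0_r.
  assert (D : ball 0 (eps / (K * x)) (dom_prim x t)).
  { apply Hd; [|exact Ht]; apply ball_R_intro.
    rewrite Rminus_0_r, Rabs_pos_eq; lra. }
  change (Rabs (dom_prim x t - 0) < eps / (K * x)) in D.
  apply Rabs_def2 in D; rewrite Rminus_0_r in D; destruct D as [D _].
  apply (Rmult_lt_compat_l (K * x)) in D; [|exact HKx].
  replace (K * x * (eps / (K * x))) with (pos eps) in D by (field; lra).
  assert (Bt := B t Ht); assert (H0 := Rabs_pos (g t)); nra.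
- exists (K * x / eps); intros t Ht; apply ball_R_intro; rewrite Rminus_0_r.
  assert (Ht0 : 0 < t)
    by (apply Rlt_trans with (2 := Ht); apply Rdiv_lt_0_compat; assumption).
  assert (Bt := B t Ht0); assert (D := dom_prim_bounds x t Hx Ht0).
  apply (Rmult_lt_compat_l eps) in Ht; [|exact He].
  replace (eps * (K * x / eps)) with (K * x) in Ht by (field; lra).
  assert (H0 := Rabs_pos (g t)).
  apply Rmult_lt_reg_r with (1 + t); [lra|]; nra.
Qed.

Lemma abs_mul_le (a b : R) : 0 <= a -> Rabs b <= 1 -> Rabs (a * b) <= a.
Proof.
intros Ha Hb; rewrite Rabs_mult, (Rabs_pos_eq a Ha).
rewrite <- (Rmult_1_r a) at 2; apply Rmult_le_compat_l; assumption.
Qed.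

(** Integration by parts: [df] is the derivative of e^-t t^z, which tends to 0 at both ends, so its
    integral is 0. *)
Lemma CGamma_S (z : C) : 0 < Re z -> CGamma (z + 1)%C = (z * CGamma z)%C.
Proof.
intros Hz.
assert (Hz1 : 0 < Re (z + 1)%C) by (destruct z; simpl in *; lra).
set (df := fun t => (z * gker 1 z t - gker 1 (z + 1) t)%C).
assert (I1 : is_RInt_gen (V := C_R_NormedModule) df
  (at_right 0) (Rbar_locally p_infty) (z * CGamma z - CGamma (z + 1))%C).
{ apply (is_RInt_gen_minus (V := C_R_NormedModule)).
    apply is_RInt_gen_Cmult, is_int_CGamma, Hz.
  apply is_int_CGamma, Hz1. }
assert (I2 : is_RInt_gen (V := C_R_NormedModule) df
  (at_right 0) (Rbar_locally p_infty) (RtoC 0)).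
{ destruct z as [x y]; simpl in Hz.
  assert (E : forall t, 0 < t -> exp (- (1 * t) + (x - 1) * ln t)
     = exp (- t + x * ln t) / t).
  { intros t Ht.
    replace (- t + x * ln t) with (- (1 * t) + (x - 1) * ln t + ln t) by ring.
    rewrite exp_plus_ln by exact Ht; field; lra. }
  assert (E' : forall t, exp (- (1 * t) + (x + 1 - 1) * ln t)
     = exp (- t + x * ln t)) by (intros; f_equal; ring).
  apply is_RInt_gen_pair.
  - assert (L : forall t, 0 < t ->
      Rabs (exp (- t + x * ln t) * cos (y * ln t)) <= exp (- t + x * ln t)).
    { intros t _; apply abs_mul_le; [apply Rlt_le, exp_pos|].
      apply Rabs_le; assert (H := COS_bound (y * ln t)); lra. }
    apply (dominated_lim_0 x _ Hz) in L; destruct L as [L0 L1].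
    change (fst (RtoC 0)) with 0; rewrite <- (Rminus_diag 0) at 2.
    refine (is_int_primitive _ _ 0 0 _ _ L0 L1).
    + intros t Ht; auto_derive; [auto|].
      simpl; rewrite E, E', Rplus_0_r by exact Ht; field; lra.
    + intros t Ht; apply (ex_derive_continuous (V := R_NormedModule)).
      unfold df, gker, Cexp; simpl; auto_derive; tauto.
  - assert (L : forall t, 0 < t ->
      Rabs (exp (- t + x * ln t) * sin (y * ln t)) <= exp (- t + x * ln t)).
    { intros t _; apply abs_mul_le; [apply Rlt_le, exp_pos|].
      apply Rabs_le; assert (H := SIN_bound (y * ln t)); lra. }
    apply (dominated_lim_0 x _ Hz) in L; destruct L as [L0 L1].
    change (snd (RtoC 0)) with 0; rewrite <- (Rminus_diag 0) at 2.
    refine (is_int_primitive _ _ 0 0 _ _ L0 L1).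
    + intros t Ht; auto_derive; [auto|].
      simpl; rewrite E, E', Rplus_0_r by exact Ht; field; lra.
    + intros t Ht; apply (ex_derive_continuous (V := R_NormedModule)).
      unfold df, gker, Cexp; simpl; auto_derive; tauto. }
assert (U := is_RInt_gen_unique (V := C_R_CompleteNormedModule) _ _ I1).
rewrite (is_RInt_gen_unique (V := C_R_CompleteNormedModule) _ _ I2) in U.
replace (CGamma (z + 1)%C)
  with (z * CGamma z - (z * CGamma z - CGamma (z + 1)))%C by ring.
rewrite <- U; ring.
Qed.

(** * Gamma has no zero in the right half-plane *)

Definition RGamma (x : R) : R := fst (CGamma (RtoC x)).

Lemma is_int_RGamma (x : R) : 0 < x ->
  is_int (fun t => exp (- t + (x - 1) * ln t)) (RGamma x).
Proof.
intros Hx; assert (H := is_RInt_gen_fst _ _ (is_int_CGamma (RtoC x) Hx)).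
revert H; apply is_int_ext; intros t Ht; simpl.
rewrite Rmult_0_l, cos_0, Rmult_1_r, Rmult_1_l; reflexivity.
Qed.

Lemma RGamma_S (x : R) : 0 < x -> RGamma (x + 1) = x * RGamma x.
Proof.
intros Hx; unfold RGamma; rewrite RtoC_plus, CGamma_S by exact Hx.
simpl; ring.
Qed.

(** Bernoulli's inequality [t^k >= 1 + k (t - 1)] turns the Gamma integral into
    an elementary one. *)
Lemma RGamma_ge_1 (x : R) : 2 <= x -> 1 <= RGamma x.
Proof.
intros Hx; set (k := x - 1).
assert (I : is_int (fun t => exp (- t) * (1 + k * (t - 1))) (0 - -1)).
{ apply (is_int_primitive (fun t => - (exp (- t) * (1 + k * t)))).
  - intros t Ht; auto_derive; [trivial|ring].
  - intros t Ht; apply (ex_derive_continuous (V := R_NormedModule)).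
    auto_derive; trivial.
  - apply (filterlim_filter_le_1 (F := locally 0)).
      apply filter_le_within.
    replace (-1) with (- (exp (- 0) * (1 + k * 0)))
      by (rewrite Ropp_0, exp_0; ring).
    apply (ex_derive_continuous (V := R_NormedModule)
      (fun t => - (exp (- t) * (1 + k * t))) 0); auto_derive; trivial.
  - destruct (dominated_lim_0 1 (fun t => t * exp (- t))) as [_ L]; [lra| |].
      intros t Ht; rewrite exp_plus, Rmult_1_l, exp_ln by exact Ht.
      rewrite Rabs_pos_eq; [lra|].
      apply Rmult_le_pos; [lra|apply Rlt_le, exp_pos].
    apply filterlim_locally; intros eps.
    assert (He : 0 < eps / (1 + k))
      by (apply Rdiv_lt_0_compat; [apply cond_pos|unfold k; lra]).
    destruct (proj1 (filterlim_locally _ _) L (mkposreal _ He)) as [M HM].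
    exists (Rmax 1 M); intros t Ht.
    assert (Ht1 := Rle_lt_trans _ _ _ (Rmax_l 1 M) Ht).
    assert (Ht2 := HM t (Rle_lt_trans _ _ _ (Rmax_r 1 M) Ht)).
    change (Rabs (t * exp (- t) - 0) < eps / (1 + k)) in Ht2.
    apply ball_R_intro; rewrite Rminus_0_r, Rabs_Ropp in *.
    assert (He0 := exp_pos (- t)).
    rewrite Rabs_pos_eq in Ht2 by (apply Rmult_le_pos; lra).
    rewrite Rabs_pos_eq by (apply Rmult_le_pos; unfold k; nra).
    apply (Rmult_lt_compat_r (1 + k)) in Ht2; [|unfold k; lra].
    replace (eps / (1 + k) * (1 + k)) with (pos eps) in Ht2
      by (field; unfold k; lra).
    assert (0 <= k) by (unfold k; lra); nra. }
assert (H := is_int_ge_0 (fun t => minus (exp (- t + (x - 1) * ln t))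
     (exp (- t) * (1 + k * (t - 1)))) (minus (RGamma x) (0 - -1))).
enough (0 <= minus (RGamma x) (0 - -1))
  by (unfold minus, plus, opp in *; simpl in *; lra).
apply H; [|apply (is_RInt_gen_minus (V := R_NormedModule));
  [apply is_int_RGamma; lra|exact I]].
intros t Ht; unfold minus, plus, opp; simpl; fold k.
rewrite exp_plus.
enough (1 + k * (t - 1) <= exp (k * ln t)) by (assert (He := exp_pos (- t)); nra).
assert (B1 := exp_ineq1_le ((k - 1) * ln t)); assert (B2 := exp_ineq1_le (- ln t)).
rewrite exp_Ropp, exp_ln in B2 by exact Ht.
replace (k * ln t) with ((k - 1) * ln t + ln t) by ring.
rewrite exp_plus, exp_ln by exact Ht.
apply (Rmult_le_compat_r t) in B2; [|lra]; rewrite Rinv_l in B2 by lra.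
apply (Rmult_le_compat_r t) in B1; [|lra].
assert (0 <= k - 1) by (unfold k; lra); nra.
Qed.

(** The right-hand side is (2 sinh(v/2))^2, and |sinh w| >= |w| by the mean value theorem and cosh
    >= 1. *)
Lemma sqr_le_exp (v : R) : v ^ 2 <= exp v - 2 + exp (- v).
Proof.
set (w := v / 2); replace v with (w + w) by (unfold w; field).
replace (- (w + w)) with (- w + - w) by ring; rewrite !exp_plus.
assert (H : exp w * exp (- w) = 1) by (rewrite <- exp_plus, Rplus_opp_r; apply exp_0).
destruct (MVT_gen (fun u => exp u - exp (- u)) 0 w (fun u => exp u + exp (- u)))
  as [c [_ E]].
- intros u _; auto_derive; [trivial|ring].
- intros u _; apply derivable_continuous_pt, ex_derive_Reals_0.
  auto_derive; trivial.
- rewrite Ropp_0, !Rminus_0_r, exp_0, Rminus_diag, Rminus_0_r in E.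
  assert (Hc : 2 <= exp c + exp (- c))
    by (assert (H1 := exp_ineq1_le c); assert (H2 := exp_ineq1_le (- c)); lra).
  assert (E2 : (exp w - exp (- w)) ^ 2 = ((exp c + exp (- c)) * w) ^ 2)
    by (rewrite E; reflexivity).
  rewrite Rpow_mult_distr in E2; assert (Hw := pow2_ge_0 w).
  assert (Hq : 4 * w ^ 2 <= (exp c + exp (- c)) ^ 2 * w ^ 2)
    by (apply Rmult_le_compat_r; [exact Hw|nra]).
  rewrite <- E2 in Hq; nra.
Qed.

(** After rotation by [x^(-iy)] the real part of the integral is at least
    [Gamma(x) (1 - y^2 / (2 (x-1)))], by [cos u >= 1 - u^2/2] and
    [ln(r)^2 <= r - 2 + 1/r] for [r = t/x]. *)
Lemma CGamma_neq_0_large (z : C) :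
  2 < Re z -> Im z ^ 2 / 2 < Re z - 1 -> CGamma z <> 0.
Proof.
destruct z as [x y]; simpl Re; simpl Im; intros Hx Hy HG.
assert (Hp : 1 <= RGamma x) by (apply RGamma_ge_1; lra).
assert (I0 := is_int_CGamma (x, y) ltac:(simpl; lra)).
apply (is_RInt_gen_Cmult _ (Cexp (0, - (y * ln x)))), is_RInt_gen_fst in I0.
rewrite HG, Cmult_0_r in I0; simpl fst in I0.
assert (I1 := is_int_RGamma x ltac:(lra)).
assert (I2 := is_int_RGamma (x + 1) ltac:(lra)).
assert (I3 := is_int_RGamma (x - 1) ltac:(lra)).
rewrite RGamma_S in I2 by lra.
assert (E3 : RGamma (x - 1) = RGamma x / (x - 1)).
{ assert (E := RGamma_S (x - 1) ltac:(lra)).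
  replace (x - 1 + 1) with x in E by ring; rewrite E; field; lra. }
rewrite E3 in I3.
(* The weights come from cos(y v) - 1 + (y^2/2) (t/x - 2 + x/t) >= 0 with v = ln(t/x); the factors t
   and 1/t shift the argument of Gamma to x + 1 and x - 1. *)
apply (is_RInt_gen_scal (V := R_NormedModule) _ (- 1 - y ^ 2)) in I1.
apply (is_RInt_gen_scal (V := R_NormedModule) _ (y ^ 2 / (2 * x))) in I2.
apply (is_RInt_gen_scal (V := R_NormedModule) _ (y ^ 2 * x / 2)) in I3.
assert (I := is_RInt_gen_plus (V := R_NormedModule) _ _ _ _ I0
  (is_RInt_gen_plus (V := R_NormedModule) _ _ _ _ I1
    (is_RInt_gen_plus (V := R_NormedModule) _ _ _ _ I2 I3))).
apply is_int_ge_0 in I.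
  unfold plus, scal in I; simpl in I; unfold mult in I; simpl in I.
  assert (E : 0 + ((-1 - y * (y * 1)) * RGamma x
    + (y * (y * 1) / (2 * x) * (x * RGamma x)
       + y * (y * 1) * x / 2 * (RGamma x / (x - 1))))
    = RGamma x * (y ^ 2 / 2 - (x - 1)) / (x - 1)) by (field; lra).
  rewrite E in I.
  apply (Rmult_le_compat_r (x - 1)) in I; [|lra].
  unfold Rdiv in I at 1; rewrite Rmult_assoc, Rinv_l, Rmult_0_l in I by lra.
  nra.
intros t Ht; unfold plus, scal; simpl; unfold mult; simpl.
set (e := exp (- t + (x - 1) * ln t)).
replace (exp (- t + (x + 1 - 1) * ln t)) with (e * t).
2:{ unfold e; rewrite <- exp_plus_ln by exact Ht; f_equal; ring. }
replace (exp (- t + (x - 1 - 1) * ln t)) with (e / t).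
2:{ unfold e.
    replace (- t + (x - 1) * ln t) with (- t + (x - 1 - 1) * ln t + ln t) by ring.
    rewrite exp_plus_ln by exact Ht; field; lra. }
rewrite exp_0, cos_neg, sin_neg, !Rmult_1_l; fold e.
replace (cos (y * ln x) * (e * cos (y * ln t))
  - - sin (y * ln x) * (e * sin (y * ln t)))
  with (e * cos (y * ln t - y * ln x)) by (rewrite cos_minus; ring).
set (v := ln t - ln x).
replace (y * ln t - y * ln x) with (y * v) by (unfold v; ring).
assert (H1 := one_minus_cos_sq (y * v)); assert (H2 := sqr_le_exp v).
unfold v in H2 at 2 3; rewrite Ropp_minus_distr in H2.
unfold Rminus in H2; rewrite !exp_plus, !exp_Ropp, !exp_ln in H2 by lra.
match goal with |- 0 <= ?G => replace G with
  (e * (cos (y * v) - 1 + y ^ 2 / 2 * (t * / x + - (2) + x * / t)))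
  by (field; lra) end.
apply Rmult_le_pos; [apply Rlt_le, exp_pos|].
assert (H3 := pow2_ge_0 y); rewrite Rpow_mult_distr in H1.
apply (Rmult_le_compat_l (y ^ 2)) in H2; [|exact H3]; lra.
Qed.

(** Adding n leaves the imaginary part fixed, so z + n eventually enters the region of
    [CGamma_neq_0_large], while a zero at z would persist at z + n. *)
Lemma CGamma_neq_0 (z : C) : 0 < Re z -> CGamma z <> 0.
Proof.
intros Hz H0.
assert (H : forall n : nat, CGamma (z + RtoC (INR n))%C = 0).
{ induction n as [|n IH].
    simpl; rewrite Cplus_0_r; exact H0.
  rewrite S_INR, RtoC_plus, Cplus_assoc, CGamma_S, IH, Cmult_0_r; [reflexivity|].
  assert (Hn := pos_INR n); destruct z; simpl in *; lra. }
destruct (exists_nat_ge (3 + Im z ^ 2 / 2)) as [n Hn].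
apply (CGamma_neq_0_large (z + RtoC (INR n))%C); [| |apply H];
  destruct z as [x y]; simpl in *; rewrite ?Rplus_0_r; nra.
Qed.

(** * The Dirichlet-type series of SLs *)

Definition SLs_coef (sigma : R) (j : nat) : R := rc sigma j * sin (sigma / 2) ^ S j.
(** log(2/(j+1)), in the shape that [Rcpow (/ a)] takes in [is_int_gker] for a = (j+1)/2. *)
Definition SLs_freq (j : nat) : R := ln (/ (INR (S j) / 2)).
Definition SLs (s : C) (sigma : R) : C :=
  CSeries (dterm (SLs_coef sigma) SLs_freq (s - 1)%C).

Lemma abs_SLs_freq (j : nat) : Rabs (SLs_freq j) <= ln (2 * INR (S j)).
Proof.
assert (H : 1 <= INR (S j)) by (rewrite S_INR; assert (H := pos_INR j); lra).
assert (H1 : 0 <= ln (INR (S j))) by (rewrite <- ln_1; apply ln_le; lra).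
assert (H2 : 0 <= ln 2) by (rewrite <- ln_1; apply ln_le; lra).
unfold SLs_freq, Rdiv.
rewrite ln_Rinv, ln_mult, ln_Rinv, ln_mult by (try apply Rmult_lt_0_compat; lra).
apply Rabs_le; lra.
Qed.

(** The exponential factor is at most (2 (j+1))^k, a polynomial in j, against the geometric decay of
    y^(j+1) with y < 1. *)
Lemma exp_summable_SLs (sigma : R) : 0 < sigma < PI ->
  exp_summable (SLs_coef sigma) SLs_freq.
Proof.
intros Hs k; set (y := sin (sigma / 2)).
assert (Hy : 0 < y < 1) by apply (half_trig_bounds sigma Hs).
assert (H : ex_series (fun j => Rabs (powers k j * y ^ j))).
{ apply CV_disk_inside; rewrite CV_radius_powers, Rabs_pos_eq by lra; simpl; lra. }
apply (ex_series_Rmult ((Rabs sigma + 2) * y * 2 ^ k)) in H.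
apply (ex_series_le (V := R_CompleteNormedModule)) with (2 := H).
intros j; unfold norm; simpl norm; unfold abs; simpl abs.
rewrite Rabs_pos_eq by (apply Rmult_le_pos; [apply Rabs_pos|apply Rlt_le, exp_pos]).
assert (Hj : 0 < 2 * INR (S j))
  by (assert (Hp := pos_INR j); rewrite S_INR; lra).
assert (E : exp (INR k * Rabs (SLs_freq j)) <= (2 * INR (S j)) ^ k).
{ rewrite <- (Rpower_pow k) by exact Hj; apply exp_le.
  apply Rmult_le_compat_l; [apply pos_INR|apply abs_SLs_freq]. }
assert (P1 : 0 <= powers k j) by (apply pow_le; lra).
assert (P2 : 0 <= y ^ j) by (apply pow_le; lra).
rewrite (Rabs_pos_eq (powers k j * y ^ j)) by (apply Rmult_le_pos; assumption).
replace ((Rabs sigma + 2) * y * 2 ^ k * (powers k j * y ^ j))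
  with ((Rabs sigma + 2) * y ^ S j * (2 * INR (S j)) ^ k)
  by (rewrite Rpow_mult_distr; unfold powers; simpl; ring).
apply Rmult_le_compat; [apply Rabs_pos|apply Rlt_le, exp_pos| |exact E].
unfold SLs_coef; fold y; rewrite Rabs_mult.
rewrite (Rabs_pos_eq (y ^ S j)) by (apply pow_le; lra).
apply Rmult_le_compat_r; [apply pow_le; lra|apply rc_bound].
Qed.

Lemma Cexp_RtoC (a : R) : Cexp (RtoC a) = RtoC (exp a).
Proof.
unfold Cexp, RtoC; simpl; rewrite cos_0, sin_0; f_equal; ring.
Qed.

(** At s = 1 - m the factor (2/(j+1))^(s-1) is ((j+1)/2)^m, the one in [pc]. *)
Lemma SLs_Psi (sigma : R) (m : nat) : 0 < sigma < PI ->
  SLs (RtoC (1 - INR m)) sigma = RtoC (Psi sigma m sigma).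
Proof.
intros Hs; unfold SLs, CSeries.
assert (E : forall j, dterm (SLs_coef sigma) SLs_freq (RtoC (1 - INR m) - 1)%C j
  = RtoC (sin (sigma / 2) * (pc sigma m j * sin (sigma / 2) ^ j))).
{ intros j; unfold dterm; rewrite <- RtoC_minus, <- RtoC_mult.
  assert (Hj : 0 < INR (S j) / 2)
    by (rewrite S_INR; assert (Hp := pos_INR j); lra).
  replace ((1 - INR m - 1) * SLs_freq j) with (INR m * ln (INR (S j) / 2))
    by (unfold SLs_freq; rewrite ln_Rinv by exact Hj; ring).
  rewrite Cexp_RtoC.
  change (exp (INR m * ln (INR (S j) / 2))) with (Rpower (INR (S j) / 2) (INR m)).
  rewrite Rpower_pow by exact Hj.
  rewrite <- RtoC_mult; f_equal; unfold SLs_coef, pc; simpl pow; ring. }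
rewrite (Series_ext _ (fun j => sin (sigma / 2)
   * (pc sigma m j * sin (sigma / 2) ^ j))) by (intros; rewrite E; reflexivity).
rewrite (Series_ext (fun j => Im _) (fun j => 0 * 0))
  by (intros; rewrite E; simpl; ring).
rewrite !Series_scal_l, Rmult_0_l; unfold Psi; rewrite PSeries_incr_1.
reflexivity.
Qed.

(** * Termwise integration *)

(** The remainder after N terms with w^(N+1) factored out, which leaves a bound uniform in N. *)
Definition rc_tail (s : R) (N : nat) (w : R) : R := PSeries (fun j => rc s (N + j)) w.

Lemma ex_series_rc_tail (s : R) (N : nat) (w : R) : 0 <= w < 1 ->
  ex_series (fun j => Rabs (rc s (N + j) * w ^ j)).
Proof.
intros Hw.
apply (ex_series_le (V := R_CompleteNormedModule)) with
  (b := fun j => (Rabs s + 2) * w ^ j).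
  intros j; unfold norm; simpl norm; unfold abs; simpl abs.
  rewrite Rabs_Rabsolu, Rabs_mult, (Rabs_pos_eq (w ^ j)) by (apply pow_le; lra).
  apply Rmult_le_compat_r; [apply pow_le; lra|apply rc_bound].
apply ex_series_Rmult, ex_series_geom; rewrite Rabs_pos_eq; lra.
Qed.

Lemma rc_tail_bound (s : R) (N : nat) (w : R) : 0 <= w < 1 ->
  Rabs (rc_tail s N w) <= (Rabs s + 2) / (1 - w).
Proof.
intros Hw; unfold rc_tail, PSeries.
eapply Rle_trans; [apply Series_Rabs, ex_series_rc_tail, Hw|].
apply Rle_trans with (Series (fun j => (Rabs s + 2) * w ^ j)).
  apply Series_le.
    intros j; split; [apply Rabs_pos|].
    rewrite Rabs_mult, (Rabs_pos_eq (w ^ j)) by (apply pow_le; lra).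
    apply Rmult_le_compat_r; [apply pow_le; lra|apply rc_bound].
  apply ex_series_Rmult, ex_series_geom; rewrite Rabs_pos_eq; lra.
rewrite Series_scal_l, Series_geom by (rewrite Rabs_pos_eq; lra).
apply Rle_refl.
Qed.

Fixpoint rc_sum (s : R) (N : nat) (w : R) : R :=
  match N with
  | O => 0
  | S M => rc_sum s M w + rc s M * w ^ S M
  end.

Lemma rc_split (s : R) (N : nat) (w : R) : 0 <= w < 1 ->
  w * PSeries (rc s) w - rc_sum s N w = w ^ S N * rc_tail s N w.
Proof.
intros Hw; induction N as [|N IH].
  unfold rc_tail; simpl; change (fun j => rc s j) with (rc s); ring.
assert (E : rc_tail s N w = rc s N + w * rc_tail s (S N) w).
{ unfold rc_tail; rewrite PSeries_decr_1.
    rewrite Nat.add_0_r; do 2 f_equal; apply PSeries_ext; intros j.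
    unfold PS_decr_1; f_equal; lia.
  apply ex_pseries_R, ex_series_Rabs, ex_series_rc_tail, Hw. }
rewrite E in IH; cbn [rc_sum]; simpl pow in *; lra.
Qed.

Section Interchange.

Variables (sigma : R) (s : C).
Hypothesis Hsigma : 0 < sigma < PI.
Hypothesis Hs : 1 < Re s.

Let y := sin (sigma / 2).
Let w (u : R) := y * exp (- u / 2).
Let h (u : R) : C := (RtoC (w u * PSeries (rc sigma) (w u)) * Rcpow u (s - 2))%C.
Let c := dterm (SLs_coef sigma) SLs_freq (s - 1)%C.

Fixpoint Csum (N : nat) : C :=
  match N with
  | O => 0%C
  | S M => (Csum M + c M)%C
  end.

Lemma y_bounds : 0 < y < 1.
Proof. apply (half_trig_bounds sigma Hsigma). Qed.

Lemma w_bounds (u : R) : 0 < u -> 0 < w u < y.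
Proof.
intros Hu; assert (Hy := y_bounds); unfold w.
assert (H1 := exp_pos (- u / 2)).
assert (H2 : exp (- u / 2) < 1) by (rewrite <- exp_0; apply exp_increasing; lra).
split; nra.
Qed.

Lemma Rcpow_gker (u : R) : Rcpow u (s - 2)%C = gker 0 (s - 1)%C u.
Proof.
rewrite gker_Rcpow, Rmult_0_l, Ropp_0, exp_0, Cmult_1_l; f_equal.
destruct s as [a b]; unfold Cminus, Cplus, Copp, RtoC; simpl; f_equal; ring.
Qed.

Lemma is_int_rc_sum (N : nat) :
  is_RInt_gen (V := C_R_NormedModule)
    (fun u => RtoC (rc_sum sigma N (w u)) * Rcpow u (s - 2))%C
    (at_right 0) (Rbar_locally p_infty) (CGamma (s - 1) * Csum N)%C.
Proof.
assert (Hs1 : 0 < Re (s - 1)%C) by (destruct s; simpl in *; lra).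
induction N as [|N IH].
  simpl; rewrite Cmult_0_r.
  assert (H := is_RInt_gen_Cmult _ 0 _ (is_int_gker 1 (s - 1)%C Rlt_0_1 Hs1)).
  rewrite Cmult_0_l in H.
  revert H; apply (is_int_ext (V := C_R_NormedModule)).
  intros u _; rewrite !Cmult_0_l; reflexivity.
assert (Ha : 0 < INR (S N) / 2)
  by (rewrite S_INR; assert (Hp := pos_INR N); lra).
assert (H := is_RInt_gen_plus (V := C_R_NormedModule) _ _ _ _ IH
  (is_RInt_gen_Cmult _ (RtoC (SLs_coef sigma N)) _ (is_int_gker _ (s - 1)%C Ha Hs1))).
replace (CGamma (s - 1) * Csum (S N))%C
  with (plus (CGamma (s - 1) * Csum N)
   (RtoC (SLs_coef sigma N) * (Rcpow (/ (INR (S N) / 2)) (s - 1) * CGamma (s - 1))))%C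
  by (cbn [Csum]; unfold c, dterm, Rcpow, SLs_freq, plus; simpl; ring).
revert H; apply (is_int_ext (V := C_R_NormedModule)).
intros u Hu; cbn [rc_sum].
rewrite RtoC_plus, Cmult_plus_distr_r.
refine (f_equal (Cplus _) _).
rewrite Rcpow_gker, (gker_Rcpow 0), gker_Rcpow, Rmult_0_l, Ropp_0, exp_0.
rewrite Cmult_1_l, Cmult_assoc, <- RtoC_mult; refine (f_equal (fun r => RtoC r * _)%C _).
unfold SLs_coef, w; fold y.
rewrite Rpow_mult_distr, <- Rmult_assoc; refine (f_equal (Rmult _) _).
rewrite <- (Rpower_pow (S N) (exp (- u / 2))) by apply exp_pos.
unfold Rpower; rewrite ln_exp; f_equal; field.
Qed.

Lemma continuous_h (u : R) : 0 < u -> continuous (U := C_R_NormedModule) h u.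
Proof.
intros Hu; unfold h.
assert (Hy := y_bounds); assert (Hw := w_bounds u Hu).
apply (continuous_ext (fun u => scal (w u * PSeries (rc sigma) (w u))
  (gker 0 (s - 1)%C u : C_R_NormedModule))).
  intros v; rewrite Rcpow_gker; apply scal_R_Cmult.
apply (continuous_scal (V := C_R_NormedModule)); [|apply continuous_gker, Hu].
assert (Cw : continuous w u).
{ apply (ex_derive_continuous (V := R_NormedModule)); unfold w; auto_derive; trivial. }
apply (continuous_mult (K := R_AbsRing)); [exact Cw|].
apply continuous_comp; [exact Cw|].
apply continuity_pt_filterlim, PSeries_continuity.
rewrite (CV_radius_ext (rc sigma) (pc sigma 0)) by (intros; unfold pc; simpl; ring).
apply CV_radius_pc; rewrite Rabs_pos_eq; lra.
Qed.

(** Of the N + 1 powers of w, one is kept for the decay e^(-u/2) at infinity; the other N give y^N,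
    which makes the remainder integrals tend to 0. *)
Lemma remainder_bound (N : nat) (u : R) : 0 < u ->
  Cmod (h u - RtoC (rc_sum sigma N (w u)) * Rcpow u (s - 2))%C
  <= (Rabs sigma + 2) / (1 - y) * y ^ N
     * exp (- (/ 2 * u) + (Re (s - 1)%C - 1) * ln u).
Proof.
intros Hu; assert (Hy := y_bounds); assert (Hw := w_bounds u Hu).
unfold h.
replace (RtoC (w u * PSeries (rc sigma) (w u)) * Rcpow u (s - 2)
   - RtoC (rc_sum sigma N (w u)) * Rcpow u (s - 2))%C
  with (RtoC (w u ^ S N * rc_tail sigma N (w u)) * Rcpow u (s - 2))%C
  by (rewrite <- rc_split by lra; rewrite RtoC_minus; ring).
rewrite Cmod_mult, Cmod_R, Rcpow_gker; unfold gker; rewrite Cmod_Cexp.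
change (Re (- (0 * u) + (Re (s - 1)%C - 1) * ln u, Im (s - 1)%C * ln u))
  with (- (0 * u) + (Re (s - 1)%C - 1) * ln u).
rewrite (exp_plus (- (/ 2 * u))), <- Rmult_assoc, exp_plus.
rewrite Rmult_0_l, Ropp_0, exp_0, Rmult_1_l.
apply Rmult_le_compat_r; [apply Rlt_le, exp_pos|].
rewrite Rabs_mult, (Rabs_pos_eq (w u ^ S N)) by (apply pow_le; lra).
assert (B : Rabs (rc_tail sigma N (w u)) <= (Rabs sigma + 2) / (1 - y)).
{ eapply Rle_trans; [apply rc_tail_bound; lra|].
  apply Rmult_le_compat_l; [assert (H := Rabs_pos sigma); lra|].
  apply Rinv_le_contravar; lra. }
assert (W : w u ^ S N <= y ^ N * exp (- (/ 2 * u))).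
{ simpl pow; rewrite Rmult_comm; apply Rmult_le_compat;
    [apply pow_le; lra|lra|apply pow_incr; lra|].
  unfold w; replace (- u / 2) with (- (/ 2 * u)) by field.
  assert (H := exp_pos (- (/ 2 * u))); nra. }
rewrite (Rmult_comm (w u ^ S N)), (Rmult_assoc ((Rabs sigma + 2) / (1 - y))).
apply Rmult_le_compat; [apply Rabs_pos|apply pow_le; lra|exact B|exact W].
Qed.

Lemma Csum_lim :
  is_lim_seq (fun N => Re (Csum N)) (Re (SLs s sigma))
  /\ is_lim_seq (fun N => Im (Csum N)) (Im (SLs s sigma)).
Proof.
destruct (ex_series_Re_Im c) as [H1 H2].
  apply ex_series_dterm, exp_summable_SLs, Hsigma.
split; apply is_lim_seq_incr_1.
- apply is_lim_seq_ext with (sum_n (fun j => Re (c j))).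
    induction n as [|n IH]; [rewrite sum_O; simpl; ring|].
    rewrite sum_Sn, IH; simpl; reflexivity.
  apply (Series_correct _ H1).
- apply is_lim_seq_ext with (sum_n (fun j => Im (c j))).
    induction n as [|n IH]; [rewrite sum_O; simpl; ring|].
    rewrite sum_Sn, IH; simpl; reflexivity.
  apply (Series_correct _ H2).
Qed.

(** Up to the factor y^N a single function dominates all remainders. N = 0 gives convergence;
    letting N grow identifies the integral with the limit of CGamma (s - 1) times the partial
    sums. *)
Lemma is_int_h :
  is_RInt_gen (V := C_R_NormedModule) h
    (at_right 0) (Rbar_locally p_infty) (CGamma (s - 1) * SLs s sigma)%C.
Proof.
assert (Hy := y_bounds).
assert (Hs1 : 0 < Re (s - 1)%C) by (destruct s; simpl in *; lra).
set (x := Re (s - 1)%C) in *.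
destruct (exp_dominated (/ 2) x ltac:(lra) Hs1) as [K [HK HD]].
set (A := (Rabs sigma + 2) / (1 - y)).
assert (HA : 0 < A)
  by (apply Rdiv_lt_0_compat; assert (H := Rabs_pos sigma); lra).
assert (Dom : forall N, let k := A * y ^ N * K in
  (forall u, 0 < u -> is_derive (fun u => k * dom_prim x u) u (k * dom x u))
  /\ (forall u, 0 < u -> continuous (fun u => k * dom x u) u)
  /\ filterlim (fun u => k * dom_prim x u) (at_right 0) (locally (k * 0))
  /\ filterlim (fun u => k * dom_prim x u) (Rbar_locally p_infty) (locally (k * 1))
  /\ (forall u, 0 < u ->
       norm (V := C_R_NormedModule)
         (h u - RtoC (rc_sum sigma N (w u)) * Rcpow u (s - 2))%C <= k * dom x u)).
{ intros N k; repeat apply conj.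
  - intros u Hu; apply is_derive_scal, is_derive_dom_prim, Hu.
  - intros u Hu; apply (continuous_scal_r (V := R_NormedModule) k), continuous_dom, Hu.
  - apply filterlim_comp with (1 := dom_prim_0 _ Hs1).
    apply (filterlim_scal_r (V := R_NormedModule)).
  - apply filterlim_comp with (1 := dom_prim_oo _ Hs1).
    apply (filterlim_scal_r (V := R_NormedModule)).
  - intros u Hu; rewrite norm_C_R.
    eapply Rle_trans; [apply remainder_bound, Hu|]; fold A; fold x.
    unfold k; rewrite (Rmult_assoc (A * y ^ N)).
    apply Rmult_le_compat_l; [|apply HD, Hu].
    apply Rmult_le_pos; [lra|apply pow_le; lra]. }
assert (Ex : exists l, is_RInt_gen (V := C_R_NormedModule) h
               (at_right 0) (Rbar_locally p_infty) l).
{ destruct (Dom 0%nat) as [D1 [D2 [D3 [D4 D5]]]].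
  refine (ex_int_dominated (V := C_R_CompleteNormedModule) h _ _ _ _ _ _ D1 D2 D3 D4).
  - exact continuous_h.
  - intros u Hu; specialize (D5 u Hu); simpl rc_sum in D5.
    rewrite Cmult_0_l in D5; unfold Cminus in D5.
    rewrite Copp_0, Cplus_0_r in D5; exact D5. }
destruct Ex as [l Hl].
assert (B : forall N, Cmod (l - CGamma (s - 1) * Csum N)%C <= A * y ^ N * K).
{ intros N; destruct (Dom N) as [D1 [D2 [D3 [D4 D5]]]].
  rewrite <- norm_C_R.
  replace (A * y ^ N * K) with (A * y ^ N * K * 1 - A * y ^ N * K * 0) by ring.
  refine (norm_int_dominated (V := C_R_CompleteNormedModule) _ _ _ _ _
    D5 D1 D2 D3 D4 _ _).
  apply (is_RInt_gen_minus (V := C_R_NormedModule)); [exact Hl|apply is_int_rc_sum]. }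
assert (Z : is_lim_seq (fun N => A * y ^ N * K) 0).
{ replace (Finite 0) with (Rbar_mult (Rbar_mult A 0) K)
    by (simpl; f_equal; ring).
  apply is_lim_seq_scal_r, is_lim_seq_scal_l, is_lim_seq_geom.
  rewrite Rabs_pos_eq; lra. }
destruct Csum_lim as [C1 C2].
assert (E : l = (CGamma (s - 1) * SLs s sigma)%C); [|rewrite <- E; exact Hl].
set (G := CGamma (s - 1)) in *.
assert (U : forall f : nat -> R, forall r : R, is_lim_seq f r ->
  (forall N, Rabs (f N) <= A * y ^ N * K) -> r = 0).
{ intros f r Hf Hb.
  assert (Hf0 : is_lim_seq f 0).
  { apply is_lim_seq_abs_0.
    apply is_lim_seq_le_le with (fun _ => 0) (fun N => A * y ^ N * K);
      [|apply is_lim_seq_const|exact Z].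
    intros N; split; [apply Rabs_pos|apply Hb]. }
  apply is_lim_seq_unique in Hf; apply is_lim_seq_unique in Hf0.
  rewrite Hf in Hf0; injection Hf0; auto. }
assert (R1 : fst l - (fst G * Re (SLs s sigma) - snd G * Im (SLs s sigma)) = 0).
{ apply (U (fun N => Re (l - G * Csum N)%C)).
  - unfold Cminus, Cmult; simpl.
    apply (is_lim_seq_plus' (fun _ => fst l)); [apply is_lim_seq_const|].
    apply (is_lim_seq_opp (fun N => fst G * Re (Csum N) - snd G * Im (Csum N))
      (fst G * Re (SLs s sigma) - snd G * Im (SLs s sigma))).
    apply is_lim_seq_minus'; apply (is_lim_seq_scal_l _ _ (Finite _)); assumption.
  - intros N; eapply Rle_trans; [apply re_le_Cmod|apply B]. }
assert (R2 : snd l - (fst G * Im (SLs s sigma) + snd G * Re (SLs s sigma)) = 0).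
{ apply (U (fun N => Im (l - G * Csum N)%C)).
  - unfold Cminus, Cmult; simpl.
    apply (is_lim_seq_plus' (fun _ => snd l)); [apply is_lim_seq_const|].
    apply (is_lim_seq_opp (fun N => fst G * Im (Csum N) + snd G * Re (Csum N))
      (fst G * Im (SLs s sigma) + snd G * Re (SLs s sigma))).
    apply is_lim_seq_plus'; apply (is_lim_seq_scal_l _ _ (Finite _)); assumption.
  - intros N; eapply Rle_trans; [apply abs_Im_le_Cmod|apply B]. }
destruct l as [l1 l2]; unfold Cmult; simpl in *; f_equal; unfold Re, Im in *; lra.
Qed.

End Interchange.

(** * The substitution [u = -2 log (sin (theta/2) / sin (sigma/2))] *)

Definition usub (sigma t : R) : R := - 2 * ln (sin (t / 2) / sin (sigma / 2)).

Lemma is_derive_usub (sigma t : R) : 0 < sigma < PI -> 0 < t < PI ->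
  is_derive (usub sigma) t (- (cos (t / 2) / sin (t / 2))).
Proof.
intros Hs Ht; unfold usub.
destruct (half_trig_bounds sigma Hs) as [Hy _].
destruct (half_trig_bounds t Ht) as [Hw _].
auto_derive.
  change (0 < sin (t / 2) / sin (sigma / 2)).
  apply Rdiv_lt_0_compat; lra.
change (t * / 2) with (t / 2); field; lra.
Qed.

Lemma usub_pos (sigma t : R) : 0 < sigma < PI -> 0 < t < sigma -> 0 < usub sigma t.
Proof.
intros Hs Ht; unfold usub.
destruct (half_trig_bounds sigma Hs) as [Hy _].
destruct (half_trig_bounds t ltac:(lra)) as [Hw _].
assert (H : sin (t / 2) < sin (sigma / 2)) by (apply sin_increasing_1; lra).
assert (H1 : ln (sin (t / 2) / sin (sigma / 2)) < 0); [|lra].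
rewrite <- ln_1; apply ln_increasing; [apply Rdiv_lt_0_compat; lra|].
apply Rmult_lt_reg_r with (sin (sigma / 2)); [lra|].
unfold Rdiv; rewrite Rmult_assoc, Rinv_l; lra.
Qed.

Lemma usub_0 (sigma : R) : 0 < sigma < PI ->
  filterlim (usub sigma) (at_right 0) (Rbar_locally p_infty).
Proof.
intros Hs P [M HM].
destruct (half_trig_bounds sigma Hs) as [Hy _].
apply at_right_0_intro with (Rmin PI (2 * (sin (sigma / 2) * exp (- M / 2)))).
  apply Rmin_pos; [apply PI_RGT_0|].
  assert (H := exp_pos (- M / 2)); apply Rmult_lt_0_compat; [lra|].
  apply Rmult_lt_0_compat; lra.
intros t [Ht0 Ht]; apply HM; unfold usub.
assert (H1 := Rlt_le_trans _ _ _ Ht (Rmin_l _ _)).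
assert (H2 := Rlt_le_trans _ _ _ Ht (Rmin_r _ _)).
destruct (half_trig_bounds t ltac:(lra)) as [Hw _].
assert (H3 := sin_lt_x (t / 2) ltac:(lra)).
assert (H4 : ln (sin (t / 2) / sin (sigma / 2)) < - M / 2); [|lra].
rewrite <- (ln_exp (- M / 2)); apply ln_increasing; [apply Rdiv_lt_0_compat; lra|].
apply Rmult_lt_reg_r with (sin (sigma / 2)); [lra|].
unfold Rdiv at 1; rewrite Rmult_assoc, Rinv_l; lra.
Qed.

Lemma at_left_pos (sigma : R) : 0 < sigma -> at_left sigma (fun t => 0 < t < sigma).
Proof.
intros Hs; exists (mkposreal _ Hs); intros t Ht Hlt; split; [|exact Hlt].
change (Rabs (t - sigma) < sigma) in Ht; apply Rabs_def2 in Ht; lra.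
Qed.

Lemma usub_sigma (sigma : R) : 0 < sigma < PI ->
  filterlim (usub sigma) (at_left sigma) (at_right 0).
Proof.
intros Hs P HP.
assert (E : usub sigma sigma = 0).
{ destruct (half_trig_bounds sigma Hs) as [Hy _].
  unfold usub; rewrite Rdiv_diag, ln_1 by lra; ring. }
assert (C : continuous (usub sigma) sigma).
{ apply (ex_derive_continuous (V := R_NormedModule)).
  eexists; apply is_derive_usub; exact Hs. }
unfold continuous in C; rewrite E in C.
assert (H1 := filter_le_within (F := locally sigma) (fun t : R => t < sigma) _ (C _ HP)).
refine (filter_imp _ _ _ (filter_and _ _ H1 (at_left_pos sigma (proj1 Hs)))).
intros t [H2 H3]; apply H2, usub_pos; assumption.
Qed.

Lemma is_RInt_gen_SLs (sigma : R) (s : C) : 0 < sigma < PI -> 1 < Re s ->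
  is_RInt_gen (V := C_R_NormedModule) (SLs_integrand s sigma)
    (at_right 0) (at_left sigma) (CGamma (s - 1) * SLs s sigma)%C.
Proof.
intros Hs Hre.
assert (H := is_int_h sigma s Hs Hre).
(* [usub] decreases, sending 0 to infinity and sigma to 0, so the orientation is reversed first; the
   resulting sign cancels that of its derivative. *)
apply (is_RInt_gen_swap (V := C_R_NormedModule)) in H.
assert (Fp : filter_prod (at_right 0) (at_left sigma) (fun ab => forall x,
    Rmin (fst ab) (snd ab) <= x <= Rmax (fst ab) (snd ab) -> 0 < x < sigma)).
{ apply Filter_prod with (fun t => 0 < t < sigma) (fun t => 0 < t < sigma).
  - apply at_right_0_intro with sigma; [apply Hs|auto].
  - apply at_left_pos, Hs.
  - intros a b Ha Hb x; simpl.
    unfold Rmin, Rmax; destruct (Rle_dec a b); lra. }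
eapply (is_RInt_gen_comp (V := C_R_CompleteNormedModule)
  (Fa := at_right 0) (Fb := at_left sigma) _
  (usub sigma) (fun t => - (cos (t / 2) / sin (t / 2)))) in H.
2: exact (usub_0 sigma Hs).
2: exact (usub_sigma sigma Hs).
- apply (is_RInt_gen_opp (V := C_R_NormedModule)) in H.
  rewrite opp_opp in H.
  revert H; apply (is_RInt_gen_ext (V := C_R_NormedModule)).
  refine (filter_imp _ _ _ Fp); intros [a b] Hab x Hx; simpl in *.
  assert (Hx' : 0 < x < sigma) by (apply Hab; lra).
  destruct (half_trig_bounds sigma Hs) as [Hy _].
  destruct (half_trig_bounds x ltac:(lra)) as [Hw Hc].
  assert (E : sin (sigma / 2) * exp (- usub sigma x / 2) = sin (x / 2)).
  { unfold usub.
    replace (- (-2 * ln (sin (x / 2) / sin (sigma / 2))) / 2)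
      with (ln (sin (x / 2) / sin (sigma / 2))) by field.
    rewrite exp_ln by (apply Rdiv_lt_0_compat; lra); field; lra. }
  rewrite E; unfold SLs_integrand; fold (usub sigma x).
  rewrite <- (PSeries_rc sigma x) by lra.
  set (r := Rcpow (usub sigma x) (s - 2)).
  set (v := PSeries (rc sigma) (sin (x / 2))).
  change (opp (scal (- (cos (x / 2) / sin (x / 2)) : R_AbsRing)
    ((sin (x / 2) * v)%R * r : C_R_NormedModule)%C) = (RtoC (cos (x / 2) * v) * r)%C).
  rewrite scal_R_Cmult; change opp with Copp.
  replace (cos (x / 2) * v)
    with (cos (x / 2) / sin (x / 2) * (sin (x / 2) * v)) by (field; lra).
  rewrite RtoC_opp, (RtoC_mult (cos (x / 2) / sin (x / 2))).
  match goal with |- @eq _ ?a ?b => change (@eq C a b) end; ring.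
- refine (filter_imp _ _ _ Fp); intros [a b] Hab x Hx; simpl in *.
  assert (Hx' := Hab x Hx).
  assert (Hxp : 0 < x < PI) by lra.
  split; [|split].
  + apply continuous_h; [exact Hs|exact Hre|apply usub_pos; assumption].
  + apply is_derive_usub; assumption.
  + destruct (half_trig_bounds x Hxp) as [Hw _].
    apply (ex_derive_continuous (V := R_NormedModule)).
    auto_derive; change (x * / 2) with (x / 2); lra.
Qed.

Theorem theorem1p2 :
  exists SLs : C -> R -> C,
    (forall sigma : R, 0 < sigma < PI ->
       entire (fun s => SLs s sigma)
       /\ (forall s : C, 1 < Re s -> is_SLs_integral s sigma (SLs s sigma))
       /\ (forall n : Z, (-1 <= n)%Z ->
             let x := sin (sigma / 2) ^ 2 in
             SLs (RtoC (IZR (- n))) sigma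
             = RtoC (x * p n x / (powerRZ 2 n * powerRZ (1 - x) (n + 1)))))
    /\ (forall n : nat,
          SLs (RtoC (- INR n)) (PI / 3)
          = RtoC (1 / 3 * sum_f_R0
              (fun k => poly_bernoulli (- Z.of_nat k) (n - k)%nat) n)).
Proof.
exists SLs; split.
- intros sigma Hs; split; [|split].
  + apply entire_CSeries, exp_summable_SLs, Hs.
  + intros s Hre; exists (CGamma (s - 1) * SLs s sigma)%C; split.
      apply is_RInt_gen_SLs; assumption.
    field; apply CGamma_neq_0; destruct s; simpl in *; lra.
  + intros n Hn x.
    set (m := Z.to_nat (n + 1)).
    assert (Em : n = (Z.of_nat m - 1)%Z) by (unfold m; lia).
    replace (IZR (- n)) with (1 - INR m)
      by (rewrite Em, opp_IZR, minus_IZR, <- INR_IZR_INZ; ring).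
    rewrite SLs_Psi by exact Hs; f_equal.
    assert (E := Psi_pq sigma m sigma Hs); cbv zeta in E; fold x in E.
    unfold p; fold m.
    assert (Hx : 0 < 1 - x).
    { destruct (half_trig_bounds sigma Hs) as [Hy _]; unfold x; nra. }
    replace (powerRZ (1 - x) (n + 1)) with ((1 - x) ^ m)
      by (rewrite pow_powerRZ; f_equal; lia).
    replace (powerRZ 2 n) with (2 ^ m / 2).
    2:{ rewrite Em; unfold Zminus; rewrite powerRZ_add by lra.
        change (powerRZ 2 (- (1))) with (/ (2 * 1)).
        rewrite pow_powerRZ, Rmult_1_r; reflexivity. }
    (* At t = s = sigma the summand with [q] vanishes and 2 x p_n(x) remains; its factor 2 turns
       2^(n+1) into 2^n. *)
    rewrite Rpow_mult_distr, Rminus_diag, !Rmult_0_l, Rplus_0_r in E.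
    assert (H2 : 2 ^ m <> 0) by (apply pow_nonzero; lra).
    assert (H3 : (1 - x) ^ m <> 0) by (apply pow_nonzero; lra).
    apply Rmult_eq_reg_r with (2 ^ m * (1 - x) ^ m);
      [|apply Rmult_integral_contrapositive; split; assumption].
    rewrite E; field; split; assumption.
- intros n.
  replace (- INR n) with (1 - INR (S n)) by (rewrite S_INR; ring).
  assert (Hpi := PI_RGT_0).
  rewrite SLs_Psi, Psi_PI3 by lra; reflexivity.
Qed.
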